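(* Let $\mathcal H$ be a separable infinite-dimensional complex Hilbert space. The connected components of $\mathcal C_1$ are parametrized by the Fredholm index; namely, two pairs $(P,Q),(P',Q')\in\mathcal C_1$ lie in the same connected component of $\mathcal C_1$ if and only if the index of $Q$ in the restricted Grassmannian of $N(P)$ coincides with the index of $Q'$ in the restricted Grassmannian of $N(P')$.
   Context: $\mathcal P(\mathcal H)$ is the set of orthogonal projections of $\mathcal H$, and $\mathcal P_\infty(\mathcal H)$ is the set of those with infinite-dimensional range and infinite-dimensional nullspace. For $P\in\mathcal P_\infty(\mathcal H)$, $\mathcal C_1(P)$ is the set of $Q\in\mathcal P(\mathcal H)$ such that $PQ$ is compact and $(1-P)-(1-P)Q(1-P)$ is compact (i.e. in the Calkin algebra $Q$ becomes $1-P$). $\mathcal C_1=\{(P,Q): P\in\mathcal P_\infty(\mathcal H),\ Q\in\mathcal C_1(P)\}$, with the topology induced by the operator norm of $\mathcal B(\mathcal H)\times\mathcal B(\mathcal H)$. For a closed subspace $\mathcal N_0\subset\mathcal H$ with orthogonal projection $E_0$, the restricted Grassmannian of $\mathcal N_0$ is the set of $Q\in\mathcal P(\mathcal H)$ such that $E_0Q|_{R(Q)}:R(Q)\to\mathcal N_0$ is Fredholm and $(1-E_0)Q|_{R(Q)}:R(Q)\to\mathcal N_0^\perp$ is compact; the index of $Q$ in it is the Fredholm index of $E_0Q|_{R(Q)}:R(Q)\to\mathcal N_0$. The set $\mathcal C_1(P)$ coincides with the restricted Grassmannian of $N(P)$. *)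

(* Defs.v *)
From HB Require Import structures.
From mathcomp Require Import all_boot all_order all_algebra.
From mathcomp Require Import complex.
From mathcomp Require Import all_classical all_reals all_analysis.

Set Implicit Arguments.
Unset Strict Implicit.
Unset Printing Implicit Defensive.

Import Order.TTheory GRing.Theory Num.Theory.
Import numFieldNormedType.Exports.

Local Open Scope classical_set_scope.
Local Open Scope complex_scope.
Local Open Scope ring_scope.

Section quotient_dimension.
Context {K : fieldType} {V : lmodType K}.
Implicit Types (W N : set V) (n : nat).

(* For subspaces W and N, the quotient N / (W `&` N) has dimension n: the
   classes modulo W of some v_0, ..., v_(n-1) in N form a basis of it. *)
Definition quotient_dim W N n := exists v : 'I_n -> V,
  [/\ forall i, N (v i),
      forall c : 'I_n -> K, W (\sum_i c i *: v i) -> forall i, c i = 0 &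
      forall x, N x -> exists c : 'I_n -> K, W (x - \sum_i c i *: v i)].

Definition has_dim N n := quotient_dim [set 0] N n.

Definition infinite_dimensional N := ~ exists n, has_dim N n.

Definition linear_subspace W :=
  W 0 /\ forall a x y, W x -> W y -> W (a *: x + y).

Lemma quotient_dim_leq W N m n : linear_subspace W ->
  quotient_dim W N m -> quotient_dim W N n -> (m <= n)%N.
Proof.
move=> [W0 WL] [u [uN uF _]] [v [_ _ vS]].
have /choice[a aP] i := vS _ (uN i).
pose A : 'M[K]_(m, n) := \matrix_(i, j) a i j.
suff fA : row_free A by rewrite -(eqP fA) rank_leq_col.
apply: inj_row_free => x xA0; apply/rowP => i; rewrite mxE.
apply: (uF (fun i => x 0 i)).
have -> : \sum_i x 0 i *: u i =
    \sum_i x 0 i *: (u i - \sum_j a i j *: v j).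
  rewrite [RHS](eq_bigr (fun i =>
      x 0 i *: u i - \sum_j (x 0 i * a i j) *: v j)); last first.
    move=> k _; rewrite scalerBr scaler_sumr; congr (_ - _).
    by apply: eq_bigr => j _; rewrite scalerA.
  rewrite sumrB exchange_big/= [X in _ - X]big1 ?subr0// => j _.
  rewrite -scaler_suml; have /rowP/(_ j) := xA0; rewrite !mxE => xA0j.
  rewrite (eq_bigr (fun k => x 0 k * A k j)) ?xA0j ?scale0r// => k _.
  by rewrite mxE.
by elim/big_ind: _ => // [y z yW zW|k _];
  [rewrite -[y]scale1r; exact: WL|rewrite -[_ *: _]addr0; exact: WL].
Qed.

Lemma quotient_dim_uniq W N m n : linear_subspace W ->
  quotient_dim W N m -> quotient_dim W N n -> m = n.
Proof. by move=> sW *; apply/eqP; rewrite eqn_leq !(@quotient_dim_leq W N). Qed.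

(* T is seen as a linear map from the subspace M to the subspace N.  For
   bounded operators between Banach spaces a cokernel of finite dimension forces
   the range to be closed. *)
Definition has_fredholm_index (M N : set V) (T : V -> V) (k : int) :=
  exists n m : nat, [/\ has_dim (M `&` T @^-1` [set 0]) n,
    quotient_dim (T @` M) N m & k = n%:Z - m%:Z].

Definition fredholm M N T := exists k, has_fredholm_index M N T k.

(* the default value 0 is only taken when T is not Fredholm *)
Definition fredholm_index M N T : int := xget 0 (has_fredholm_index M N T).

Lemma fredholm_indexE (M N : set V) (T : {linear V -> V}) k :
  linear_subspace M -> has_fredholm_index M N T k -> fredholm_index M N T = k.
Proof.
move=> [M0 ML] Tk; apply: xget_unique => // l [n' [m' [n'P m'P ->]]].
have [n [m [nP mP ->]]] := Tk.
have sV : linear_subspace (T @` M).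
  split=> [|a _ _ [x Mx <-] [y My <-]]; first by exists 0; rewrite ?linear0.
  by exists (a *: x + y); [exact: ML|rewrite linearP].
have s0 : linear_subspace ([set 0] : set V).
  by split=> // a x y /= -> ->; rewrite scaler0 addr0.
by rewrite (quotient_dim_uniq s0 n'P nP) (quotient_dim_uniq sV m'P mP).
Qed.

End quotient_dimension.

Definition separable_space (T : topologicalType) :=
  exists2 D : set T, countable D & dense D.

HB.mixin Record CompleteNormedModule_isHilbert (R : realType) V
    of CompleteNormedModule R[i] V := {
  inner : {dot V for (@Num.conj R[i])} ;
  inner_norm : forall x : V, inner x x = `|x| ^+ 2 }.

#[short(type="hilbertType")]
HB.structure Definition Hilbert (R : realType) :=
  {V of CompleteNormedModule R[i] V & CompleteNormedModule_isHilbert R V}.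

Section bounded_operators.
Context {R : realType} {V : normedModType R[i]}.

Definition bounded_linear : {pred V -> V} := mem [set f : V -> V |
  linear f /\ exists M : R, forall x, `|f x| <= M%:C * `|x|].

Record bounded_op := BoundedOp {
  bounded_op_fun :> V -> V ;
  bounded_opP : bounded_op_fun \in bounded_linear }.

HB.instance Definition _ := [isSub for bounded_op_fun].
HB.instance Definition _ := [Choice of bounded_op by <:].


Lemma bounded_linear_submod : submod_closed bounded_linear.
Proof.
split=> [|a f g].
  rewrite inE/=; split=> [b x y|]; first by rewrite scaler0 addr0.
  by exists 0 => x; rewrite mul0r normr0.
rewrite !inE/= => -[lf [M fM]] [lg [N gN]]; split=> [b x y|].
  rewrite /= !fctE lf lg !scalerDr !scalerA addrACA (mulrC a b) -!scalerA.
  by [].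
have [c ac] : exists c : R, `|a| = c%:C.
  by exists (complex.Re `|a|); rewrite RRe_real// normr_real.
exists (c * M + N) => x; rewrite /= !fctE rmorphD rmorphM/= mulrDl.
rewrite (le_trans (ler_normD _ _))// lerD// normrZ -mulrA ac.
by rewrite ler_wpM2l// -ac.
Qed.

HB.instance Definition _ :=
  GRing.isSubmodClosed.Build _ _ bounded_linear bounded_linear_submod.
HB.instance Definition _ := [SubChoice_isSubLmodule of bounded_op by <:].

Lemma bounded_op_linear (f : bounded_op) : linear f.
Proof. by case: f => f /=; rewrite inE => -[]. Qed.

HB.instance Definition _ (f : bounded_op) :=
  GRing.isLinear.Build _ _ _ _ (f : V -> V) (bounded_op_linear f).

Lemma bounded_op_bounded (f : bounded_op) :
  exists M : R, forall x, `|f x| <= M%:C * `|x|.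
Proof. by case: f => f /=; rewrite inE => -[]. Qed.

Fact bounded_op_id_subproof : (id : V -> V) \in bounded_linear.
Proof. by rewrite inE; split=> //; exists 1 => x; rewrite mul1r. Qed.

Fact bounded_op_comp_subproof (f g : bounded_op) :
  (f \o g : V -> V) \in bounded_linear.
Proof.
rewrite inE; split=> [a x y|]; first by rewrite /= !linearP.
have [M fM] := bounded_op_bounded f; have [N gN] := bounded_op_bounded g.
exists (`|M| * N) => x; rewrite rmorphM/= -mulrA (le_trans (fM _))//.
apply: (@le_trans _ _ (`|M|%:C * `|g x|)).
  by rewrite ler_wpM2r// lecR ler_norm.
by rewrite ler_wpM2l// lecR.
Qed.

Definition bounded_op_id := BoundedOp bounded_op_id_subproof.
Definition bounded_op_comp f g := BoundedOp (bounded_op_comp_subproof f g).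

Fact bounded_op_compA : associative bounded_op_comp.
Proof. by move=> f g h; exact/val_inj. Qed.

Fact bounded_op_comp1f : left_id bounded_op_id bounded_op_comp.
Proof. by move=> f; exact/val_inj. Qed.

Fact bounded_op_compf1 : right_id bounded_op_id bounded_op_comp.
Proof. by move=> f; exact/val_inj. Qed.

Fact bounded_op_compDl : left_distributive bounded_op_comp +%R.
Proof. by move=> f g h; exact/val_inj. Qed.

Fact bounded_op_compDr : right_distributive bounded_op_comp +%R.
Proof. by move=> f g h; apply/val_inj/funext => x /=; rewrite linearD. Qed.

(* the product of B(V) is the composition of operators *)
HB.instance Definition _ := GRing.Zmodule_isPzRing.Build bounded_op
  bounded_op_compA bounded_op_comp1f bounded_op_compf1 bounded_op_compDl
  bounded_op_compDr.

Definition unit_ball_image (f : bounded_op) : set R :=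
  [set complex.Re `|f x| | x in [set x : V | `|x| <= 1]].

(* The norm of V takes its values in R[i], as does the operator norm. *)
Definition op_norm (f : bounded_op) : R[i] := (sup (unit_ball_image f))%:C.

Local Fact complex_ReE (z : R[i]) : 0 <= z -> (complex.Re z)%:C = z.
Proof. by move=> z0; rewrite RRe_real// ger0_real. Qed.

Local Fact complex_Re_norm (x : V) : (complex.Re `|x|)%:C = `|x|.
Proof. exact: complex_ReE. Qed.

Fact unit_ball_sup f : has_sup (unit_ball_image f).
Proof.
split; first by exists 0, 0; rewrite /= ?normr0// linear0 normr0.
have [M fM] := bounded_op_bounded f.
exists `|M| => _ [x /= x1 <-].
rewrite -lecR complex_Re_norm (le_trans (fM x))//.
apply: (@le_trans _ _ (`|M|%:C * `|x|)).
  by rewrite ler_wpM2r// lecR ler_norm.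
by rewrite ler_piMr// lecR.
Qed.

Lemma op_norm_ge0 f : 0 <= op_norm f.
Proof.
rewrite /op_norm lecR; apply: ub_le_sup; first exact: (unit_ball_sup f).2.
by exists 0; rewrite /= ?normr0// linear0 normr0.
Qed.

Lemma op_norm_unit (f : bounded_op) x : `|x| <= 1 -> `|f x| <= op_norm f.
Proof.
move=> x1; rewrite -complex_Re_norm lecR.
by apply: ub_le_sup; [exact: (unit_ball_sup f).2|exists x].
Qed.

Lemma ler_op_norm (f : bounded_op) x : `|f x| <= op_norm f * `|x|.
Proof.
have [->|x0] := eqVneq x 0; first by rewrite linear0 !normr0 mulr0.
have nx0 : 0 < `|x| by rewrite normr_gt0.
rewrite -ler_pdivrMr//.
have := @op_norm_unit f (`|x|^-1 *: x).
rewrite linearZ/= !normrZ normfV normr_id mulVf ?gt_eqF// mulrC.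
exact.
Qed.

Lemma op_norm_le (f : bounded_op) (M : R[i]) :
  (forall x, `|x| <= 1 -> `|f x| <= M) -> op_norm f <= M.
Proof.
move=> fM; have M0 : 0 <= M.
  by have := fM 0; rewrite linear0 !normr0; exact.
rewrite -[M]complex_ReE// lecR; apply: ge_sup; first exact: (unit_ball_sup f).1.
by move=> _ [x x1 <-]; rewrite -lecR complex_Re_norm complex_ReE// fM.
Qed.

Fact op_normD f g : op_norm (f + g) <= op_norm f + op_norm g.
Proof.
apply: op_norm_le => x x1; rewrite (le_trans (ler_normD _ _))//.
by rewrite lerD// op_norm_unit.
Qed.

Fact op_normZ (a : R[i]) f : op_norm (a *: f) = `|a| * op_norm f.
Proof.
have nZ b g : op_norm (b *: g) <= `|b| * op_norm g.
  by apply: op_norm_le => x x1; rewrite normrZ ler_wpM2l// op_norm_unit.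
have [->|a0] := eqVneq a 0.
  by apply/eqP; rewrite eq_le nZ normr0 mul0r op_norm_ge0.
apply/eqP; rewrite eq_le nZ/= -ler_pdivlMl ?normr_gt0// -normfV.
by rewrite -{1}[f](scalerK a0) nZ.
Qed.

Fact op_norm_eq0 f : op_norm f = 0 -> f = 0.
Proof.
move=> f0; apply/val_inj/funext => x /=; apply/eqP; rewrite -normr_le0.
by rewrite (le_trans (ler_op_norm f x))// f0 mul0r.
Qed.

HB.instance Definition _ :=
  Lmodule_isNormed.Build R[i] bounded_op op_normD op_normZ op_norm_eq0.

End bounded_operators.
Arguments bounded_op {R} V.

Section restricted_grassmannian.
Context {R : realType} {H : hilbertType R}.
Implicit Types (P Q E : bounded_op H) (M : set H).

Definition kernel P : set H := P @^-1` [set 0].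

Definition is_orthoproj P :=
  P * P = P /\ forall x y : H, inner (P x) y = inner x (P y).

Definition is_orthoproj_infty P := [/\ is_orthoproj P,
  infinite_dimensional (range P) & infinite_dimensional (kernel P)].

Definition compact_on M (T : H -> H) :=
  precompact (T @` [set x | M x /\ `|x| <= 1]).

Definition compact_op (T : bounded_op H) := compact_on setT T.

Definition C1_fiber P : set (bounded_op H) := [set Q | [/\ is_orthoproj Q,
  compact_op (P * Q) & compact_op ((1 - P) - (1 - P) * Q * (1 - P))]].

Definition C1 : set (bounded_op H * bounded_op H) :=
  [set PQ | is_orthoproj_infty PQ.1 /\ C1_fiber PQ.1 PQ.2].

(* The closed subspace N_0 = range E is given by its orthogonal projection E. *)
Definition restricted_grassmannian E : set (bounded_op H) :=
  [set Q | [/\ is_orthoproj Q, fredholm (range Q) (range E) (E * Q) &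
               compact_on (range Q) ((1 - E) * Q)]].

Definition restricted_index E Q : int :=
  fredholm_index (range Q) (range E) (E * Q).

Lemma range_compl P : is_orthoproj P -> range (1 - P : bounded_op H) = kernel P.
Proof.
move=> [PP _]; apply/seteqP; split=> [_ [x _ <-]|x /= Px].
  rewrite /kernel/= linearB/= -[P (P x)]/((P * P) x) PP.
  by rewrite subrr.
by exists x => //=; rewrite !fctE Px oppr0 addr0.
Qed.

End restricted_grassmannian.

(* Main.v *)
Require Import Defs.
From mathcomp Require Import all_boot all_order all_algebra.
From mathcomp Require Import complex.
From mathcomp Require Import all_classical all_reals all_analysis.
From mathcomp Require Import ring lra.

(* Put E = 1 - P; membership of (P, Q) in C_1 means that E - Q is compact.

   Fix a small r. As (1 - E) Q is compact, Q has a subprojection D of finite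
   corank n with |(1 - E) D| <= r. Then E is bounded below on the range of D, it
   maps that range onto the range of a projection M <= E of finite corank c, and
   the index is n - c. For a nearby pair (E', Q'), the projections onto the images
   of the range of D under Q' and E' Q' are close to D and M, so that they have
   the same coranks: the index is locally constant.

   Conversely, projections onto the images of a fixed subspace under a path of
   operators, bounded below on it, form a path. Such a path moves Q, with E
   fixed, to the sum of M and of a projection of rank n orthogonal to E, after
   which the pair is described by n, c and an orthonormal sequence whose span
   has infinite codimension. Two orthogonal sequences e and f are joined by
   (1 - t) e + t f, and any two sequences by a chain of three such steps. Since
   n can be any large number, pairs with the same index can be brought to forms
   with the same n and c. *)

Set Implicit Arguments.
Unset Strict Implicit.
Unset Printing Implicit Defensive.

Import Order.TTheory GRing.Theory Num.Theory.
Import numFieldNormedType.Exports.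

Local Open Scope classical_set_scope.
Local Open Scope complex_scope.
Local Open Scope ring_scope.

(** * Norms with values in the ordered field [R] instead of [R[i]] *)

Section real_norm.
Context {R : realType}.

(** The difficulty is to produce, compare and move projections onto images. No closed-range theorem
    or polar decomposition is used: the operators that need an adjoint are built together with it,
    and a lower bound d on the range of D makes a coercive operator invertible, which yields the
    projection onto the image. The same bound makes this projection depend on the operator with
    Lipschitz constant 2 / d, and operators with compact difference have projections with compact
    difference. Hence two segments of operators, uniformly bounded below and with compact difference
    at both ends, give a Lipschitz path in C_1.

    Linear interpolation can destroy the lower bound. It does not do so between orthogonal images of
    equal norm, because (1 - t)^2 + t^2 >= 1/2. This is why sequences move through auxiliary
    orthogonal ones, and why the finite-rank part Q - D is sent into the kernel of E.

    On the index side, bounded projections at distance below 1 have the same dimension, and what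
    remains is the rank of a matrix. *)

Definition nrm {V : normedZmodType R[i]} (x : V) : R := complex.Re `|x|.

Lemma nrmE (V : normedZmodType R[i]) (x : V) : `|x| = (nrm x)%:C.
Proof. by rewrite /nrm RRe_real// normr_real. Qed.

Lemma nrm_ge0 (V : normedZmodType R[i]) (x : V) : 0 <= nrm x.
Proof. by rewrite -lecR -nrmE normr_ge0. Qed.

Lemma nrm0 (V : normedZmodType R[i]) : nrm (0 : V) = 0.
Proof. by rewrite /nrm normr0. Qed.

Lemma nrm_eq0 (V : normedZmodType R[i]) (x : V) : nrm x = 0 -> x = 0.
Proof. by move=> x0; apply/eqP; rewrite -normr_eq0 nrmE x0. Qed.

Lemma nrm_gt0 (V : normedZmodType R[i]) (x : V) : x != 0 -> 0 < nrm x.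
Proof. by move=> x0; rewrite -ltcR -nrmE normr_gt0. Qed.

Lemma nrmN (V : normedZmodType R[i]) (x : V) : nrm (- x) = nrm x.
Proof. by rewrite /nrm normrN. Qed.

Lemma nrmC (V : normedZmodType R[i]) (x y : V) : nrm (x - y) = nrm (y - x).
Proof. by rewrite -nrmN opprB. Qed.

Lemma nrmD (V : normedZmodType R[i]) (x y : V) : nrm (x + y) <= nrm x + nrm y.
Proof. by rewrite -lecR rmorphD/= -!nrmE ler_normD. Qed.

Lemma nrmB (V : normedZmodType R[i]) (x y : V) : nrm (x - y) <= nrm x + nrm y.
Proof. by rewrite -(nrmN y) nrmD. Qed.

Lemma nrm_triangle (V : normedZmodType R[i]) (y x z : V) :
  nrm (x - z) <= nrm (x - y) + nrm (y - z).
Proof. by rewrite (le_trans _ (nrmD _ _))// subrKA. Qed.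

Lemma nrm_sub_ge (V : normedZmodType R[i]) (x y : V) :
  nrm x - nrm y <= nrm (x + y).
Proof. by rewrite lerBlDr (le_trans _ (nrmB _ _))// addrK. Qed.

Lemma nrmZ (V : normedModType R[i]) a (x : V) : nrm (a *: x) = nrm a * nrm x.
Proof. by apply: (@complexI R); rewrite rmorphM/= -!nrmE normrZ. Qed.

Lemma nrmM (a b : R[i]) : nrm (a * b) = nrm a * nrm b.
Proof. by apply: (@complexI R); rewrite rmorphM/= -!nrmE normrM. Qed.

Lemma nrm_real (a : R) : nrm a%:C = `|a|.
Proof. by apply: (@complexI R); rewrite -nrmE normc_def/= expr0n addr0 sqrtr_sqr. Qed.

Lemma nrm_pos (a : R) : 0 <= a -> nrm a%:C = a.
Proof. by move=> a0; rewrite nrm_real ger0_norm. Qed.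

Lemma nrm_conj (a : R[i]) : nrm (a^*)%R = nrm a.
Proof. by rewrite /nrm norm_conjC. Qed.

Lemma nrm1 : nrm (1 : R[i]) = 1.
Proof. by rewrite /nrm normr1. Qed.

Lemma Re_le_nrm (a : R[i]) : complex.Re a <= nrm a.
Proof.
rewrite -lecR -nrmE normc_def lecR/=; case: a => a b /=.
by rewrite (le_trans (ler_norm _))// -sqrtr_sqr ler_wsqrtr// lerDl sqr_ge0.
Qed.

End real_norm.

(** * Inner product, Cauchy-Schwarz and sequential convergence *)

Section hilbert.
Context {R : realType} {H : hilbertType R}.
Implicit Types x y z : H.

Lemma innerDl x y z : inner (x + y) z = inner x z + inner y z.
Proof. by rewrite linearDl. Qed.
Lemma innerDr x y z : inner z (x + y) = inner z x + inner z y.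
Proof. by rewrite linearDr. Qed.
Lemma innerNl x y : inner (- x) y = - inner x y.
Proof. by rewrite linearNl. Qed.
Lemma innerNr x y : inner y (- x) = - inner y x.
Proof. by rewrite linearNr. Qed.
Lemma innerBl x y z : inner (x - y) z = inner x z - inner y z.
Proof. by rewrite linearBl. Qed.
Lemma innerBr x y z : inner z (x - y) = inner z x - inner z y.
Proof. by rewrite linearBr. Qed.
Lemma innerZl (a : R[i]) x y : inner (a *: x) y = a * inner x y.
Proof. by rewrite linearZl_LR. Qed.
Lemma innerZr (a : R[i]) x y : inner x (a *: y) = (a^*)%R * inner x y.
Proof. by rewrite linearZr_LR. Qed.
Lemma inner0l x : inner 0 x = 0 :> R[i].
Proof. by rewrite linear0l. Qed.
Lemma inner0r x : inner x 0 = 0 :> R[i].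
Proof. by rewrite linear0r. Qed.
Lemma innerC x y : inner x y = ((inner y x : R[i])^*)%R.
Proof. by rewrite hermC/= expr0 mul1r. Qed.

Lemma inner_suml I (r : seq I) (P : pred I) (F : I -> H) y :
  inner (\sum_(i <- r | P i) F i) y = \sum_(i <- r | P i) inner (F i) y :> R[i].
Proof.
by elim/big_rec2 : _ => [|i a b _ <-]; [exact: inner0l|rewrite innerDl].
Qed.

Lemma inner_sumr I (r : seq I) (P : pred I) (F : I -> H) y :
  inner y (\sum_(i <- r | P i) F i) = \sum_(i <- r | P i) inner y (F i) :> R[i].
Proof.
by elim/big_rec2 : _ => [|i a b _ <-]; [exact: inner0r|rewrite innerDr].
Qed.

Lemma inner_nrm x : inner x x = (nrm x ^+ 2)%:C.
Proof. by rewrite inner_norm nrmE rmorphXn. Qed.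

Lemma nrm_sqr x : nrm x ^+ 2 = complex.Re (inner x x).
Proof. by rewrite inner_nrm. Qed.

Lemma inner_eq0 x : inner x x = 0 :> R[i] -> x = 0.
Proof.
rewrite inner_nrm => -[] /eqP; rewrite expf_eq0/= => /eqP.
exact: nrm_eq0.
Qed.

Lemma inner_ext x y : (forall z, inner x z = inner y z :> R[i]) -> x = y.
Proof.
by move=> xy; apply/subr0_eq/inner_eq0; rewrite innerBl xy subrr.
Qed.

Lemma nrm_sqrD x y :
  nrm (x + y) ^+ 2 = nrm x ^+ 2 + nrm y ^+ 2 + complex.Re (inner x y) *+ 2.
Proof.
rewrite !nrm_sqr innerDl !innerDr (innerC y x).
case: (inner x x) => a1 a2; case: (inner y y) => b1 b2.
by case: (inner x y) => c1 c2 /=; ring.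
Qed.

Lemma nrm_sqrD_orth x y : inner x y = 0 :> R[i] ->
  nrm (x + y) ^+ 2 = nrm x ^+ 2 + nrm y ^+ 2.
Proof. by move=> xy; rewrite nrm_sqrD xy mul0rn addr0. Qed.

(** Pythagoras for x, split into its component along y and the orthogonal rest. *)
Lemma inner_le x y : nrm (inner x y : R[i]) <= nrm x * nrm y.
Proof.
have [->|y0] := eqVneq y 0; first by rewrite inner0r !nrm0 mulr0.
have ny : 0 < nrm y by exact: nrm_gt0.
have ny2 : inner y y != 0 :> R[i].
  by rewrite inner_nrm (inj_eq (@complexI R)) expf_eq0/= gt_eqF.
pose a : R[i] := inner x y / inner y y.
have o : inner (x - a *: y) (a *: y) = 0 :> R[i].
  by rewrite innerZr innerBl innerZl /a divfK// subrr mulr0.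
have := nrm_sqrD_orth o; rewrite subrK nrmZ => xE.
have aE : nrm a = nrm (inner x y : R[i]) / nrm y ^+ 2.
  apply: (canRL (mulfK _)); first by rewrite expf_eq0/= gt_eqF.
  rewrite -[X in nrm a * X]nrm_pos ?sqr_ge0// -nrmM -inner_nrm.
  by rewrite /a divfK.
have : (nrm a * nrm y) ^+ 2 <= nrm x ^+ 2 by rewrite xE lerDr sqr_ge0.
rewrite ler_sqr ?nnegrE ?mulr_ge0 ?nrm_ge0// aE.
by rewrite expr2 invfM mulrA mulfVK ?gt_eqF// ler_pdivrMr.
Qed.

Definition converges (u : nat -> H) x :=
  forall e : R, 0 < e -> exists N, forall n, (N <= n)%N -> nrm (u n - x) < e.

Lemma hilbert_complete (u : nat -> H) :
  (forall e : R, 0 < e -> exists N, forall m n, (N <= m)%N -> (m <= n)%N ->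
     nrm (u n - u m) < e) ->
  exists x, converges u x.
Proof.
move=> uC.
have : cvg (u @ \oo).
  apply/cauchy_cvgP/cauchy_ballP => e e0.
  have eE : e = (complex.Re e)%:C by rewrite RRe_real// gtr0_real.
  have e0' : 0 < complex.Re e by rewrite -ltcR -eE.
  have [N uN] := uC _ e0'.
  near_simpl; exists ([set n | N <= n], [set n | N <= n])%N.
    by split; exists N.
  move=> [m n] /= [Nm Nn]; rewrite -ball_normE/= nrmE eE ltcR.
  by have [mn|/ltnW nm] := leqP m n; [rewrite nrmC|]; exact: uN.
move=> /cvg_ex[x ux]; exists x => e e0.
have e0' : 0 < e%:C by rewrite ltcR.
move/cvgrPdist_lt : ux => /(_ _ e0')[N _ uN]; exists N => n Nn.
by have := uN n Nn; rewrite /= nrmE ltcR nrmC.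
Qed.

(** Meant for partial sums of orthonormal expansions, whose coordinates are eventually constant. *)
Lemma converges_inner (u : nat -> H) x y (c : R[i]) : converges u x ->
  (exists N, forall n, (N <= n)%N -> inner (u n) y = c) -> inner x y = c.
Proof.
move=> ux [N uN]; apply/eqP; rewrite -subr_eq0; apply/eqP/nrm_eq0.
apply/le_anti; rewrite nrm_ge0 andbT; apply/ler_addgt0Pr => e e0; rewrite add0r.
have e1 : 0 < e / (nrm y + 1) by rewrite divr_gt0// ltr_wpDl// nrm_ge0.
have [M uM] := ux _ e1.
rewrite -(uN (maxn M N)) ?leq_maxr// -innerBl (le_trans (inner_le _ _))//.
rewrite nrmC; have := uM (maxn M N) (leq_maxl _ _); rewrite ltr_pdivlMr; last first.
  by rewrite ltr_wpDl// nrm_ge0.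
by move/ltW; apply: le_trans; rewrite ler_wpM2l ?nrm_ge0// lerDl.
Qed.

Lemma converges_le (u : nat -> H) x (c : R) : converges u x ->
  (exists N, forall n, (N <= n)%N -> nrm (u n) <= c) -> nrm x <= c.
Proof.
move=> ux [N uN]; apply/ler_addgt0Pr => e e0.
have [M uM] := ux _ e0.
have := uN (maxn M N) (leq_maxr _ _); have := uM (maxn M N) (leq_maxl _ _).
move=> h1 h2; rewrite -(subrK (u (maxn M N)) x) (le_trans (nrmD _ _))//.
by rewrite addrC lerD// nrmC ltW.
Qed.

End hilbert.

(** * Operator estimates, adjoint pairs and inversion of coercive operators *)

Section operators.
Context {R : realType} {H : hilbertType R}.
Implicit Types (S T U : bounded_op H) (x y z : H).

Lemma opD S T x : (S + T) x = S x + T x. Proof. by []. Qed.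
Lemma opN S x : (- S) x = - S x. Proof. by []. Qed.
Lemma opB S T x : (S - T) x = S x - T x. Proof. by []. Qed.
Lemma opZ (a : R[i]) S x : (a *: S) x = a *: S x. Proof. by []. Qed.
Lemma opM S T x : (S * T) x = S (T x). Proof. by []. Qed.
Lemma op1 x : (1 : bounded_op H) x = x. Proof. by []. Qed.
Lemma op0 x : (0 : bounded_op H) x = 0. Proof. by []. Qed.
Definition opE := (opD, opN, opB, opZ, opM, op1, op0).

Lemma op_sub T x y : T (x - y) = T x - T y. Proof. exact: raddfB. Qed.

Lemma op_ext S T : (forall x, S x = T x) -> S = T.
Proof. by move=> ST; exact/val_inj/funext. Qed.

Lemma op_build (f : H -> H) (M : R) : linear f ->
  (forall x, nrm (f x) <= M * nrm x) -> exists T : bounded_op H, T = f :> (H -> H).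
Proof.
move=> lf fM.
have fP : f \in (bounded_linear : {pred H -> H}).
  rewrite inE; split => //; exists M => x.
  by rewrite !nrmE -rmorphM lecR.
by exists (BoundedOp fP).
Qed.

Lemma nrm_op T x : nrm (T x) <= nrm T * nrm x.
Proof. by rewrite -lecR rmorphM/= -!nrmE; exact: ler_op_norm. Qed.

Lemma nrm_op_le T (M : R) : 0 <= M -> (forall x, nrm (T x) <= M * nrm x) ->
  nrm T <= M.
Proof.
move=> M0 TM; rewrite -lecR -nrmE; apply: op_norm_le => x x1.
rewrite nrmE lecR (le_trans (TM x))// -[leRHS]mulr1 ler_wpM2l//.
by rewrite -lecR -nrmE.
Qed.

Lemma nrm_opM S T : nrm (S * T) <= nrm S * nrm T.
Proof.
apply: nrm_op_le => [|x]; first by rewrite mulr_ge0 ?nrm_ge0.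
by rewrite -mulrA (le_trans (nrm_op S _))// ler_wpM2l ?nrm_ge0// nrm_op.
Qed.

Lemma nrm_op_lt1_eq0 T x : nrm T < 1 -> T x = x -> x = 0.
Proof.
move=> T1 Tx; apply/eqP; apply: contraT => /nrm_gt0 x0.
by have := nrm_op T x; rewrite Tx ler_pMl// leNgt T1.
Qed.

Lemma conj_real (a : R) : ((a%:C)^*)%R = a%:C.
Proof. by rewrite conj_Creal// realE -[0]/(0%:C) !lecR le_total. Qed.

(** A relation instead of an operation: an adjoint is exhibited together with its operator, so that
    no existence theorem is involved. *)
Definition adj S T := forall x y, inner (S x) y = inner x (T y) :> R[i].

Lemma adj_sym S T : adj S T -> adj T S.
Proof. by move=> ST x y; rewrite innerC -ST -innerC. Qed.

Lemma adjD S T S' T' : adj S T -> adj S' T' -> adj (S + S') (T + T').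
Proof. by move=> h h' x y; rewrite !opE innerDl innerDr h h'. Qed.

Lemma adjN S T : adj S T -> adj (- S) (- T).
Proof. by move=> h x y; rewrite !opE innerNl innerNr h. Qed.

Lemma adjB S T S' T' : adj S T -> adj S' T' -> adj (S - S') (T - T').
Proof. by move=> h h'; exact: adjD h (adjN h'). Qed.

Lemma adjZ (a : R) S T : adj S T -> adj (a%:C *: S) (a%:C *: T).
Proof.
by move=> h x y; rewrite !opE innerZl innerZr h conj_real.
Qed.

Lemma adjM S T S' T' : adj S T -> adj S' T' -> adj (S * S') (T' * T).
Proof. by move=> h h' x y; rewrite !opE h h'. Qed.

Lemma adj1 : adj 1 1. Proof. by []. Qed.

Lemma adj_uniq S T T' : adj S T -> adj S T' -> T = T'.
Proof.
by move=> h h'; apply: op_ext => x; apply: inner_ext => y; rewrite innerC -h h' -innerC.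
Qed.

Lemma adj_nrm_le S T : adj S T -> nrm T <= nrm S.
Proof.
move=> ST; apply: nrm_op_le => [|x]; first exact: nrm_ge0.
have [->|Tx0] := eqVneq (T x) 0; first by rewrite nrm0 mulr_ge0 ?nrm_ge0.
rewrite -(ler_pM2r (nrm_gt0 Tx0)) -expr2 nrm_sqr.
rewrite (le_trans (Re_le_nrm _))// -(ST (T x) x) (le_trans (inner_le _ _))//.
by rewrite mulrAC ler_wpM2r ?nrm_ge0// nrm_op.
Qed.

Lemma adj_nrm S T : adj S T -> nrm T = nrm S.
Proof.
by move=> ST; apply/le_anti; rewrite !adj_nrm_le//; exact: adj_sym.
Qed.

Lemma cvg_expr_lt (q e : R) : 0 <= q -> q < 1 -> 0 < e ->
  exists N, forall n, (N <= n)%N -> q ^+ n < e.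
Proof.
move=> q0 q1 e0; have := @cvg_expr R q; rewrite ger0_norm// => /(_ q1).
move=> /cvgrPdist_lt/(_ e e0)[N _ h]; exists N => n /h /=.
by rewrite sub0r normrN ger0_norm// exprn_ge0.
Qed.

(** Telescoping turns the bound on the steps into [K / (1 - q) * (q ^+ m - q ^+ (m + k))], which is
    small uniformly in k. *)
Lemma geometric_converges (u : nat -> H) (K q : R) : 0 <= q -> q < 1 ->
  (forall n, nrm (u n.+1 - u n) <= K * q ^+ n) -> exists x, converges u x.
Proof.
move=> q0 q1 uq; apply: hilbert_complete => e e0.
have q1' : 0 < 1 - q by rewrite subr_gt0.
have K0 : 0 <= K by have := le_trans (nrm_ge0 _) (uq 0%N); rewrite expr0 mulr1.
have uk m k : nrm (u (m + k)%N - u m) <= K / (1 - q) * (q ^+ m - q ^+ (m + k)).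
  elim: k => [|k IH]; first by rewrite addn0 !subrr nrm0 mulr0.
  rewrite (le_trans (nrm_triangle (u (m + k)%N) _ _))// addrC addnS.
  rewrite (le_trans (lerD IH (uq _)))//.
  have -> : K * q ^+ (m + k) = K / (1 - q) * (q ^+ (m + k) - q ^+ (m + k).+1).
    by rewrite exprS; field; rewrite gt_eqF.
  by rewrite -mulrDr addrA subrK.
have [N qN] := cvg_expr_lt q0 q1 (divr_gt0 e0 (ltr_wpDl (divr_ge0 K0 (ltW q1')) ltr01)).
exists N => m n Nm mn; rewrite -(subnKC mn) (le_lt_trans (uk _ _))//.
have := qN m Nm; rewrite ltr_pdivlMr; last exact: ltr_wpDl (divr_ge0 K0 (ltW q1')) ltr01.
rewrite mulrC.
apply: le_lt_trans; rewrite mulrDl mul1r -[leLHS]addr0 lerD//.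
  by rewrite ler_wpM2l ?(divr_ge0 K0 (ltW q1'))// gerBl exprn_ge0.
by rewrite exprn_ge0.
Qed.

(** The equation T x = y is solved by iterating x - c (T x - y). With |T| <= M and c = m / M^2,
    expanding the square shows that x - c T x has squared norm at most (1 - (m / M)^2) |x|^2, so the
    iteration contracts. Coercivity bounds the inverse by 1 / m. *)
Lemma lax_milgram T (m : R) : 0 < m ->
  (forall x, m * nrm x ^+ 2 <= complex.Re (inner (T x) x)) ->
  exists S, T * S = 1 /\ S * T = 1.
Proof.
move=> m0 Tm.
have Tge x : m * nrm x <= nrm (T x).
  have [->|x0] := eqVneq x 0; first by rewrite nrm0 mulr0 nrm_ge0.
  rewrite -(ler_pM2r (nrm_gt0 x0)) -mulrA -expr2 (le_trans (Tm x))//.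
  by rewrite (le_trans (Re_le_nrm _))// inner_le.
(* Adding m makes M positive and gives m / M <= 1 without a case distinction. *)
pose M := nrm T + m.
have M0 : 0 < M by rewrite ltr_wpDl// nrm_ge0.
have MT x : nrm (T x) <= M * nrm x.
  by rewrite (le_trans (nrm_op _ _))// ler_wpM2r ?nrm_ge0// lerDl ltW.
pose c := m / M ^+ 2.
have c0 : 0 < c by rewrite divr_gt0// exprn_gt0.
pose q2 := 1 - (m / M) ^+ 2.
have mM : m / M <= 1 by rewrite ler_pdivrMr// mul1r lerDr nrm_ge0.
have mM0 : 0 < m / M by exact: divr_gt0.
have q20 : 0 <= q2 by rewrite subr_ge0 expr_le1// (ltW mM0).
have q21 : q2 < 1 by rewrite gtrBl exprn_gt0.
pose q := Num.sqrt q2.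
have q0 : 0 <= q by exact: sqrtr_ge0.
have q1 : q < 1 by rewrite -sqrtr1 ltr_sqrt.
have contr x : nrm (x - c%:C *: T x) <= q * nrm x.
  rewrite -ler_sqr ?nnegrE ?mulr_ge0 ?nrm_ge0// exprMn sqr_sqrtr//.
  rewrite nrm_sqrD nrmN nrmZ nrm_pos ?(ltW c0)// innerNr innerZr.
  rewrite innerC conj_real.
  have := Tm x; case: (inner (T x) x) => a b /= ab.
  rewrite mul0r subr0 /q2.
  have h : (c * nrm (T x)) ^+ 2 <= (m / M) ^+ 2 * nrm x ^+ 2.
    have l0 : 0 <= c * nrm (T x) by rewrite mulr_ge0 ?nrm_ge0// ltW.
    have r0 : 0 <= m / M * nrm x by rewrite mulr_ge0 ?nrm_ge0// ltW.
    rewrite -exprMn ler_sqr//.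
    rewrite (le_trans (ler_wpM2l (ltW c0) (MT x)))// mulrA.
    by rewrite /c expr2 invfM mulrA mulfVK ?gt_eqF.
  have ce : c * m = (m / M) ^+ 2 by rewrite /c expr_div_n mulrAC -expr2.
  have h2 : c * (m * nrm x ^+ 2) <= c * a by rewrite ler_pM2l.
  by rewrite mulrA ce in h2; lra.
have solve y : exists x, T x = y.
  pose u n := iter n (fun x => x - c%:C *: (T x - y)) 0.
  have stepB p p' : p - c%:C *: (T p - y) - (p' - c%:C *: (T p' - y)) =
      (p - p') - c%:C *: T (p - p').
    rewrite [T (p - _)]linearB/= !scalerBr [- (p' - _)]opprD addrACA.
    by congr (_ + _); rewrite opprK !opprB addrC addrA subrK.
  have du n : u n.+2 - u n.+1 = (u n.+1 - u n) - c%:C *: T (u n.+1 - u n).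
    exact: (stepB (u n.+1) (u n)).
  have uq n : nrm (u n.+1 - u n) <= nrm (u 1%N - u 0%N) * q ^+ n.
    elim: n => [|n IH]; first by rewrite expr0 mulr1.
    rewrite du (le_trans (contr _))// exprS mulrCA.
    by rewrite ler_wpM2l.
  have [x ux] := geometric_converges q0 q1 uq.
  exists x; apply/subr0_eq/nrm_eq0/le_anti; rewrite nrm_ge0 andbT.
  apply/ler_addgt0Pr => e e0; rewrite add0r.
  have K0 : 0 < c^-1 *+ 2 + M by rewrite addr_gt0// pmulrn_rgt0// invr_gt0.
  have [N uN] := ux _ (divr_gt0 e0 K0).
  have h1 := uN _ (leqnn N); have h2 := uN _ (leqnSn N).
  (* As u_N - u_(N+1) = c (T u_N - y), the residual at x is controlled by two consecutive iterates
     close to x. *)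
  have -> : T x - y = c^-1%:C *: (u N - u N.+1) - T (u N - x).
    rewrite [u N.+1]/(u N - c%:C *: (T (u N) - y)) subKr scalerA.
    by rewrite -rmorphM mulVf ?gt_eqF// scale1r [T (_ - x)]linearB/= opprB [RHS]addrC subrKA.
  rewrite (le_trans (nrmB _ _))// nrmZ nrm_pos ?invr_ge0 ?(ltW c0)//.
  have h3 : nrm (u N - u N.+1) <= (e / (c^-1 *+ 2 + M)) *+ 2.
    by rewrite (le_trans (nrm_triangle x _ _))// mulr2n lerD//; [|rewrite nrmC]; exact: ltW.
  have h4 := le_trans (MT (u N - x)) (ler_wpM2l (ltW M0) (ltW h1)).
  have ci : 0 <= c^-1 by rewrite invr_ge0 ltW.
  rewrite (le_trans (lerD (ler_wpM2l ci h3) h4))//.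
  have -> : forall t, c^-1 * (t *+ 2) + M * t = t * (c^-1 *+ 2 + M) by move=> t; ring.
  by rewrite divfK// gt_eqF.
have [S0 S0P] := choice solve.
have Tinj x y : T x = T y -> x = y.
  move=> xy; apply/subr0_eq/nrm_eq0/le_anti; rewrite nrm_ge0 andbT.
  by rewrite -(pmulr_rle0 _ m0) (le_trans (Tge _))// linearB/= xy subrr nrm0.
have S0lin : linear S0.
  by move=> a x y; apply: Tinj; rewrite S0P /= linearD linearZ/= !S0P.
have [|S SE] := op_build (M := m^-1) S0lin.
  by move=> x; rewrite ler_pdivlMl// (le_trans (Tge _))// S0P.
exists S; split; apply: op_ext => x; rewrite !opE SE ?S0P//.
by apply: Tinj; rewrite S0P.
Qed.

End operators.

(** * Orthogonal projections and projections onto images *)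

Section projections.
Context {R : realType} {H : hilbertType R}.
Implicit Types (P Q D E F S T U p : bounded_op H) (x y z : H).

Lemma oproj_adj P : is_orthoproj P -> adj P P.
Proof. by case. Qed.

Lemma oproj_idem P : is_orthoproj P -> P * P = P.
Proof. by case. Qed.

Lemma oproj_fix P x : is_orthoproj P -> P (P x) = P x.
Proof. by move=> [PP _]; rewrite -opM PP. Qed.

Lemma oproj_compl P : is_orthoproj P -> is_orthoproj (1 - P).
Proof.
move=> [PP sP]; split; last exact: (adjB adj1 sP).
by rewrite mulrBl mul1r mulrBr mulr1 PP subrr subr0.
Qed.

Lemma oprojP P x : is_orthoproj P -> range P x <-> P x = x.
Proof.
move=> pP; split=> [[y _ <-]|Px]; first exact: oproj_fix.
by exists x.
Qed.

Lemma oproj_pythagoras P x : is_orthoproj P ->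
  nrm x ^+ 2 = nrm (P x) ^+ 2 + nrm (x - P x) ^+ 2.
Proof.
move=> pP; have Pxx : P (x - P x) = 0 by rewrite raddfB/= oproj_fix// subrr.
have o : inner (P x) (x - P x) = 0 :> R[i] by rewrite (oproj_adj pP) Pxx inner0r.
by rewrite -(nrm_sqrD_orth o) addrC subrK.
Qed.

Lemma oproj_nrm P x : is_orthoproj P -> nrm (P x) <= nrm x.
Proof.
move=> pP; rewrite -ler_sqr ?nnegrE ?nrm_ge0// (oproj_pythagoras x pP).
by rewrite lerDl sqr_ge0.
Qed.

Lemma oproj_nrm1 P : is_orthoproj P -> nrm P <= 1.
Proof. by move=> pP; apply: nrm_op_le => // x; rewrite mul1r oproj_nrm. Qed.

Lemma oproj_mulC P D : is_orthoproj P -> is_orthoproj D -> P * D = D -> D * P = D.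
Proof.
move=> pP pD PD; apply: adj_uniq (oproj_adj pD).
by rewrite -{1}PD; exact: adjM (oproj_adj pP) (oproj_adj pD).
Qed.

Lemma oproj_sub P D : is_orthoproj P -> is_orthoproj D -> P * D = D ->
  is_orthoproj (P - D).
Proof.
move=> pP pD PD; split; last exact: adjB (oproj_adj pP) (oproj_adj pD).
rewrite mulrBl !mulrBr PD (oproj_mulC pP pD PD) !oproj_idem//.
by rewrite subrr subr0.
Qed.

Lemma oproj_add P D : is_orthoproj P -> is_orthoproj D -> P * D = 0 ->
  is_orthoproj (P + D).
Proof.
move=> pP pD PD; split; last exact: adjD (oproj_adj pP) (oproj_adj pD).
have DP : D * P = 0.
  have a0 : adj (0 : bounded_op H) 0 by move=> x y; rewrite !op0 inner0l inner0r.
  by apply: adj_uniq a0; rewrite -PD; exact: adjM (oproj_adj pP) (oproj_adj pD).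
by rewrite mulrDl !mulrDr PD DP !oproj_idem// addr0 add0r.
Qed.

(* p projects onto the range of T; the factorization through T makes it closed. *)
Definition rproj p T := [/\ is_orthoproj p, p * T = T & exists B, p = T * B].

Lemma rproj_id P : is_orthoproj P -> rproj P P.
Proof. by move=> pP; split; rewrite ?oproj_idem//; exists P; rewrite oproj_idem. Qed.

Lemma rproj_mull p T S : rproj p T -> S * T = T -> S * p = p.
Proof. by move=> [_ _ [B ->]] ST; rewrite mulrA ST. Qed.

Lemma rproj_uniq p p' T : rproj p T -> rproj p' T -> p = p'.
Proof.
move=> rp rp'; have [pp pT _] := rp; have [pp' pT' _] := rp'.
exact: etrans (esym (oproj_mulC pp' pp (rproj_mull rp pT'))) (rproj_mull rp' pT).
Qed.

Definition bounded_below T D (d : R) :=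
  [/\ T * D = T, 0 < d & forall x, d * nrm (D x) <= nrm (T x)].

(* p = T A^-1 T^* for the coercive operator A = T^* T + (1 - D). *)
Lemma rproj_exists T T' D d : is_orthoproj D -> adj T T' -> bounded_below T D d ->
  exists p, rproj p T.
Proof.
move=> pD TT' [TD d0 dT].
have DT' : D * T' = T'.
  by have := adjM TT' (oproj_adj pD); rewrite TD => /adj_uniq; exact.
pose A := T' * T + (1 - D).
(* T^* T is at least d^2 on the range of D, and 1 - D is the identity on its complement. *)
pose m := Num.min (d ^+ 2) 1.
have m0 : 0 < m by rewrite lt_min exprn_gt0/=.
have [|Ai [AAi AiA]] := @lax_milgram _ _ A m m0.
  move=> x; rewrite (oproj_pythagoras x pD) mulrDr /A opD innerDl.
  have -> : inner ((T' * T) x) x = inner (T x) (T x) :> R[i].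
    exact: (adj_sym TT').
  have -> : inner ((1 - D) x) x = inner ((1 - D) x) ((1 - D) x) :> R[i].
    have pC := oproj_compl pD.
    by rewrite [RHS](oproj_adj pC) (oproj_fix x pC) -(oproj_adj pC).
  rewrite !inner_nrm /= lerD//.
    rewrite (@le_trans _ _ (d ^+ 2 * nrm (D x) ^+ 2))//.
      by rewrite ler_wpM2r ?sqr_ge0// ge_min lexx.
    rewrite -exprMn ler_sqr ?nnegrE ?nrm_ge0//.
    by rewrite mulr_ge0 ?nrm_ge0// ltW.
  by rewrite -[leRHS]mul1r ler_wpM2r ?sqr_ge0// ge_min lexx orbT.
have AD : A * D = T' * T.
  by rewrite /A mulrDl mulrBl mul1r oproj_idem// subrr addr0 -mulrA TD.
have AiTT : Ai * T' * T = D by rewrite -mulrA -AD mulrA AiA mul1r.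
have sA : adj A A by apply: adjD (adjM (adj_sym TT') TT') (adjB adj1 (oproj_adj pD)).
have sAi : adj Ai Ai.
  move=> x y; rewrite -{1}[y]op1 -AAi opM -sA -[in LHS]opM AAi op1.
  by [].
exists (T * Ai * T'); split; last by exists (Ai * T'); rewrite mulrA.
  split; first by rewrite -!mulrA (mulrA T') (mulrA Ai) (mulrA Ai) AiTT mulrA TD.
  exact: (adjM (adjM TT' sAi) (adj_sym TT')).
by rewrite -!mulrA (mulrA Ai) AiTT TD.
Qed.

(** The factor in [rproj], cut by D, is controlled: d |C x| <= |T C x| = |p x| <= |x|. *)
Lemma rproj_bound p T D d : is_orthoproj D -> bounded_below T D d -> rproj p T ->
  exists C, [/\ p = T * C, D * C = C & nrm C <= d^-1].
Proof.
move=> pD [TD d0 dT] [pp pT [B pE]]; exists (D * B); split.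
- by rewrite mulrA TD.
- by rewrite mulrA oproj_idem.
- apply: nrm_op_le => [|x]; first by rewrite invr_ge0 ltW.
  rewrite ler_pdivlMl// (le_trans (dT _))// -opM -pE.
  exact: oproj_nrm.
Qed.

Lemma oproj_subE p p' : p - p' = p * (1 - p') - (1 - p) * p'.
Proof. by rewrite mulrBr mulr1 mulrBl mul1r opprB addrA subrK. Qed.

(** Both corners of p - p' are small. Since p' fixes T', (1 - p') p = (1 - p') (T - T') C with |C|
    <= 1 / d; the corner p (1 - p') is the adjoint of this one, and (1 - p) p' is treated with the
    roles exchanged. *)
Lemma rproj_near p p' T T' D D' d : is_orthoproj D -> is_orthoproj D' ->
  bounded_below T D d -> bounded_below T' D' d -> rproj p T -> rproj p' T' ->
  nrm (p - p') <= (nrm (T - T') / d) *+ 2.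
Proof.
move=> pD pD' bT bT' rp rp'.
have aux q q' S S' E : is_orthoproj E -> bounded_below S E d ->
    rproj q S -> rproj q' S' -> nrm ((1 - q') * q) <= nrm (S - S') / d.
  move=> pE bS rq [pq' qS' _]; have [C [-> _ nC]] := rproj_bound pE bS rq.
  have -> : (1 - q') * (S * C) = (1 - q') * (S - S') * C.
    by rewrite mulrBr [(1 - q') * S']mulrBl mul1r qS' subrr subr0 mulrA.
  rewrite (le_trans (nrm_opM _ _))// ler_pM ?nrm_ge0//.
  rewrite (le_trans (nrm_opM _ _))// -[leRHS]mul1r ler_wpM2r ?nrm_ge0//.
  exact/oproj_nrm1/oproj_compl.
have [[pp _ _] [pp' _ _]] := (rp, rp').
rewrite oproj_subE (le_trans (nrmB _ _))// mulr2n lerD//; last first.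
  by rewrite (nrmC T); exact: aux pD' bT' rp' rp.
rewrite (@adj_nrm _ _ ((1 - p') * p)); first exact: aux pD bT rp rp'.
by apply: adjM; [exact/oproj_adj/oproj_compl|exact: oproj_adj].
Qed.

End projections.

(** * Continuity from Lipschitz bounds *)

Section lipschitz.
Context {R : realType}.

Lemma lipschitz_continuous (V W : normedModType R[i]) (f : V -> W) (M : R) :
  (forall x y, nrm (f x - f y) <= M * nrm (x - y)) -> continuous f.
Proof.
move=> fM x; apply/cvgrPdist_lt => e e0.
have eE : e = (complex.Re e)%:C by rewrite RRe_real// gtr0_real.
have e0' : 0 < complex.Re e by rewrite -ltcR -eE.
have M0 : 0 < `|M| + 1 by rewrite ltr_wpDl.
have : 0 < (complex.Re e / (`|M| + 1))%:C by rewrite ltcR divr_gt0.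
move=> /(nbhsx_ballx x); apply: filterS => y.
rewrite -ball_normE/= !nrmE ltcR ltr_pdivlMr// mulrC => xy.
rewrite eE ltcR (le_lt_trans _ xy)// (le_trans (fM _ _))//.
by rewrite ler_wpM2r ?nrm_ge0// (le_trans (ler_norm _))// lerDl.
Qed.

Lemma lipschitz_path (W : normedModType R[i]) (f : R -> W) (M : R) :
  (forall s t, nrm (f s - f t) <= M * `|s - t|) -> continuous f.
Proof.
move=> fM x; apply/cvgrPdist_lt => e e0.
have eE : e = (complex.Re e)%:C by rewrite RRe_real// gtr0_real.
have e0' : 0 < complex.Re e by rewrite -ltcR -eE.
have M0 : 0 < `|M| + 1 by rewrite ltr_wpDl.
have : 0 < complex.Re e / (`|M| + 1) by rewrite divr_gt0.
move=> /(nbhsx_ballx x); apply: filterS => y.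
rewrite -ball_normE/= ltr_pdivlMr// mulrC => xy.
rewrite nrmE eE ltcR (le_lt_trans _ xy)// (le_trans (fM _ _))//.
by rewrite ler_wpM2r// (le_trans (ler_norm _))// lerDl.
Qed.

End lipschitz.

(** * Compact operators, through total boundedness *)

Section compact_operators.
Context {R : realType} {H : hilbertType R}.
Implicit Types (S T U : bounded_op H) (x y z : H).

Lemma op_continuous T : continuous (T : H -> H).
Proof.
by apply: (@lipschitz_continuous _ _ _ _ (nrm T)) => x y; rewrite -raddfB nrm_op.
Qed.

Lemma compact_opP T :
  compact_op T <-> exists2 K : set H, compact K & forall x, nrm x <= 1 -> K (T x).
Proof.
split=> [[K TK [cK _]]|[K cK TK]].
  exists K => // x x1; apply: TK; exists x => //=; split => //.
  by rewrite nrmE -[1]/(1%:C) lecR.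
exists K; last by split => //; exact: compact_closed.
move=> _ [x [_ x1] <-]; apply: TK.
by move: x1; rewrite nrmE -[1]/(1%:C) lecR.
Qed.

Lemma compact_opD S T : compact_op S -> compact_op T -> compact_op (S + T).
Proof.
move=> /compact_opP[K cK SK] /compact_opP[L cL TL]; apply/compact_opP.
exists ((fun p : H * H => p.1 + p.2) @` (K `*` L)).
  apply: continuous_compact; last exact: compact_setX.
  exact/continuous_subspaceT/add_continuous.
by move=> x x1; exists (S x, T x) => //=; split; [exact: SK|exact: TL].
Qed.

Lemma compact_op_mull S T : compact_op T -> compact_op (S * T).
Proof.
move=> /compact_opP[K cK TK]; apply/compact_opP; exists (S @` K).
  by apply: continuous_compact => //; exact/continuous_subspaceT/op_continuous.
by move=> x x1; exists (T x) => //; exact: TK.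
Qed.

Lemma scale_op_lmul (a : R[i]) T : a *: T = (a *: (1 : bounded_op H)) * T.
Proof. exact: op_ext. Qed.

Lemma compact_opZ (a : R[i]) T : compact_op T -> compact_op (a *: T).
Proof. by move=> cT; rewrite scale_op_lmul; exact: compact_op_mull. Qed.

Lemma compact_opN T : compact_op T -> compact_op (- T).
Proof. by move=> cT; rewrite -scaleN1r; exact: compact_opZ. Qed.

Lemma compact_opB S T : compact_op S -> compact_op T -> compact_op (S - T).
Proof. by move=> cS cT; apply: compact_opD => //; exact: compact_opN. Qed.

Lemma compact_op_mulr S T : compact_op T -> compact_op (T * S).
Proof.
move=> cT; have s0 : 0 < nrm S + 1 by rewrite ltr_wpDl// nrm_ge0.
have s1 : (nrm S + 1)%:C != 0 :> R[i] by rewrite (inj_eq (@complexI R)) gt_eqF.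
have /compact_opP[K cK TK] := compact_opZ (nrm S + 1)%:C cT.
apply/compact_opP; exists K => // x x1.
have <- : (((nrm S + 1)%:C *: T) ((nrm S + 1)%:C^-1 *: S x)) = (T * S) x.
  by rewrite !opE linearZ/= scalerA mulfV// scale1r.
apply: TK; rewrite nrmZ -rmorphV/= ?unitfE ?gt_eqF// nrm_pos ?invr_ge0; last first.
  by rewrite addr_ge0 ?nrm_ge0.
rewrite ler_pdivrMl// mulr1 (le_trans (nrm_op _ _))//.
by rewrite (le_trans (ler_wpM2l (nrm_ge0 _) x1))// mulr1 lerDl.
Qed.

(** The centres are images of points of the unit ball: they lie in the range, and differences with
    the points that they approximate stay bounded by 2 before T is applied. *)
Definition totally_bounded_op T := forall e : R, 0 < e ->
  exists2 l : seq H, forall z, z \in l -> nrm z <= 1 &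
    forall x, nrm x <= 1 -> exists2 z, z \in l & nrm (T x - T z) < e.

Lemma ball_nrm (V : normedModType R[i]) (x y : V) (e : R) :
  ball x e%:C y <-> nrm (x - y) < e.
Proof. by rewrite -ball_normE/= nrmE ltcR. Qed.

Lemma compact_op_totally_bounded T : compact_op T -> totally_bounded_op T.
Proof.
move=> /compact_opP[K cK TK] e e0.
have e20 : 0 < (e / 2)%:C :> R[i] by rewrite ltcR divr_gt0.
have : cover_compact K by rewrite -compact_cover.
move=> /(_ H setT (fun y => (ball y (e / 2)%:C)°)) [].
  by move=> y _; exact: open_interior.
  by move=> y _; exists y => //; exact: nbhsx_ballx.
move=> D _ KD.
(* A centre y of the cover need not be an image; it is replaced by a nearby image of a point of the
   ball if there is one, and by T 0 otherwise. *)
have zex y : exists z, nrm z <= 1 /\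
    ((exists2 x, nrm x <= 1 & nrm (y - T x) < e / 2) -> nrm (y - T z) < e / 2).
  have [[x x1 xy]|nx] := pselect (exists2 x, nrm x <= 1 & nrm (y - T x) < e / 2).
    by exists x.
  by exists 0; rewrite nrm0.
have [z zP] := choice zex.
exists [seq z y | y <- finmap.enum_fset D].
  by move=> _ /mapP[y _ ->]; exact: (zP y).1.
move=> x x1; have [y yD /interior_subset/ball_nrm yTx] := KD _ (TK _ x1).
exists (z y); first by apply: map_f.
rewrite (le_lt_trans (nrm_triangle y _ _))// (splitr e) ltrD//; first by rewrite nrmC.
by apply: (zP y).2; exists x.
Qed.

Lemma ultra_seq_cover (T : choiceType) (A : Type) (F : set_system A) (l : seq T)
    (B : T -> set A) : UltraFilter F ->
  F [set a | exists2 z, z \in l & B z a] -> exists2 z, z \in l & F (B z).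
Proof.
move=> UF; elim: l => [|z l IH] Fl.
  have /filter_ex[] // : F set0 by apply: filterS Fl => a [].
have [FB|FB] := in_ultra_setVsetC (B z) UF.
  by exists z => //; rewrite mem_head.
have [|w wl FBw] := IH; last by exists w => //; rewrite in_cons wl orbT.
apply: filterS (filterI Fl FB) => a [[w + wa] nza].
by rewrite in_cons => /predU1P[wz|wl]; [rewrite wz in wa|exists w].
Qed.

(** Finitely many balls of any given radius cover the closure of the image, and an ultrafilter on it
    selects one of them. It is therefore Cauchy, and completeness provides the limit. *)
Lemma totally_bounded_compact_op T : totally_bounded_op T -> compact_op T.
Proof.
move=> tT; rewrite /compact_op /compact_on precompactE.
set A := T @` _; rewrite compact_ultra => F UF FA.
have FC : cauchy F.
  apply/cauchy_exP => e e0.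
  have eE : e = (complex.Re e)%:C by rewrite RRe_real// gtr0_real.
  have e0' : 0 < complex.Re e by rewrite -ltcR -eE.
  have [l _ lP] := tT _ (divr_gt0 e0' (ltr0Sn _ 1)).
  have [|z zl Fz] := @ultra_seq_cover _ _ F l
      (fun z => ball (T z) e) UF; last by exists (T z).
  apply: filterS FA => y Ay.
  have e20 : 0 < (complex.Re e / 2)%:C :> R[i] by rewrite ltcR divr_gt0.
  have [_ [[x [_ x1] <-] /ball_nrm yx]] := Ay _ (nbhsx_ballx y _ e20).
  have [|z zl xz] := lP x; first by rewrite -lecR -nrmE.
  exists z => //; rewrite eE; apply/ball_nrm.
  by rewrite (le_lt_trans (nrm_triangle (T x) _ _))// nrmC (splitr (complex.Re e)) ltrD// nrmC.
have /cvg_ex[y Fy] : cvg F by exact/cauchy_cvgP.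
exists y; split => //; apply: (closed_cvg _ _ FA) => //.
exact: closed_closure.
Qed.

(** |T (x - z)|^2 = <x - z, S T (x - z)> <= 2 |S T (x - z)|, so the points of an e^2 / 2 net for S T
    give an e net for T. *)
Lemma compact_op_TT S T : adj T S -> compact_op (S * T) -> compact_op T.
Proof.
move=> TS /compact_op_totally_bounded cST; apply: totally_bounded_compact_op => e e0.
have [l l1 lP] := cST (e ^+ 2 / 2) (divr_gt0 (exprn_gt0 _ e0) (ltr0Sn _ 1)).
exists l => // x x1; have [z zl xz] := lP x x1; exists z => //.
rewrite -ltr_sqr ?nnegrE ?nrm_ge0 ?ltW// nrm_sqr -raddfB/= TS.
rewrite innerC (le_lt_trans (Re_le_nrm _))// nrm_conj.
rewrite (le_lt_trans (inner_le _ _))// -opM raddfB/=.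
have : nrm (x - z) <= 2 by rewrite (le_trans (nrmB _ _))// -[2]/(1 + 1) lerD// l1.
move=> /(ler_wpM2l (nrm_ge0 ((S * T) x - (S * T) z)))/le_lt_trans; apply.
by rewrite -ltr_pdivlMr.
Qed.

(** Schauder's theorem: [T * S] is compact, and it is the product of S with its adjoint on the
    left. *)
Lemma compact_op_adj S T : adj T S -> compact_op T -> compact_op S.
Proof.
by move=> TS cT; apply: compact_op_TT (adj_sym TS) _; exact: compact_op_mulr.
Qed.

(** The coefficients of the image of the ball are enclosed in a square of the complex plane, so that
    compactness of real segments is enough. *)
Lemma rank1_compact T a : (forall x, exists c, T x = c *: a) -> compact_op T.
Proof.
move=> Ta.
have [a0|a0] := eqVneq a 0.
  rewrite a0 in Ta; apply/compact_opP; exists [set 0]; first exact: compact_set1.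
  by move=> x _; have [c ->] := Ta x; rewrite scaler0.
pose M := nrm T / nrm a.
have cK b : compact ((fun t : R => t%:C *: b : H) @` `[- M, M]).
  apply: continuous_compact; last exact: segment_compact.
  apply: continuous_subspaceT; apply: (@lipschitz_path _ _ _ (nrm b)) => s t.
  by rewrite -scalerBl -rmorphB nrmZ nrm_real mulrC.
apply/compact_opP.
exists ((fun p : H * H => p.1 + p.2) @` (((fun t : R => t%:C *: a : H) @` `[- M, M]) `*`
    ((fun t : R => t%:C *: ('i *: a) : H) @` `[- M, M]))).
  apply: continuous_compact; last exact: compact_setX.
  exact/continuous_subspaceT/add_continuous.
move=> x x1; have [c cE] := Ta x.
have cM : nrm c <= M.
  rewrite ler_pdivlMr ?nrm_gt0// -nrmZ -cE (le_trans (nrm_op _ _))//.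
  by rewrite -[leRHS]mulr1 ler_wpM2l ?nrm_ge0.
have nN (b : R) : `|b| <= nrm c -> `[- M, M]%classic b.
  by move=> bc; rewrite /= in_itv/= -ler_norml (le_trans bc).
have ce : nrm c = Num.sqrt (complex.Re c ^+ 2 + complex.Im c ^+ 2).
  by apply: (@complexI R); rewrite -nrmE normc_def.
exists ((complex.Re c)%:C *: a, (complex.Im c)%:C *: ('i *: a)) => /=.
  split; [exists (complex.Re c)|exists (complex.Im c)] => //; apply: nN.
    by rewrite ce -sqrtr_sqr ler_wsqrtr// lerDl sqr_ge0.
  by rewrite ce -sqrtr_sqr ler_wsqrtr// lerDr sqr_ge0.
rewrite scalerA -scalerDl cE; congr (_ *: _).
by rewrite [RHS]complexE mulrC.
Qed.

Lemma compact_op0 : compact_op (0 : bounded_op H).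
Proof. by apply: (@rank1_compact _ 0) => x; exists 0; rewrite scaler0. Qed.

(** The corner computation of [rproj_near], with compactness of T - T' in place of its norm. *)
Lemma rproj_compact p p' T T' D D' d d' : is_orthoproj D -> is_orthoproj D' ->
  bounded_below T D d -> bounded_below T' D' d' -> rproj p T -> rproj p' T' ->
  compact_op (T - T') -> compact_op (p - p').
Proof.
move=> pD pD' bT bT' rp rp' cTT.
have aux q q' S S' : rproj q S -> rproj q' S' -> compact_op (S - S') ->
    compact_op ((1 - q') * q).
  move=> [_ _ [C ->]] [_ qS' _] cS.
  have -> : (1 - q') * (S * C) = (1 - q') * ((S - S') * C).
    rewrite [in RHS]mulrA mulrBr [(1 - q') * S']mulrBl mul1r qS' subrr subr0.
    by rewrite mulrA.
  exact/compact_op_mull/compact_op_mulr.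
have [[pp _ _] [pp' _ _]] := (rp, rp').
rewrite oproj_subE; apply: compact_opB; last first.
  by apply: aux rp' rp _; rewrite -opprB; exact: compact_opN.
apply: compact_op_adj (aux _ _ _ _ rp rp' cTT).
by apply: adjM; [exact/oproj_adj/oproj_compl|exact: oproj_adj].
Qed.

End compact_operators.

(** * Dimension counts and orthonormal families *)

Section dimension.
Context {R : realType} {H : hilbertType R}.
Implicit Types (W : set H) (p : bounded_op H) (x y z u : H) (e : nat -> H).

Definition free_family n (v : 'I_n -> H) :=
  forall c : 'I_n -> R[i], \sum_i c i *: v i = 0 -> forall i, c i = 0.

Lemma free_family_leq m n (u : 'I_m -> H) (v : 'I_n -> H) : free_family u ->
  (forall i, exists c : 'I_n -> R[i], u i = \sum_j c j *: v j) -> (m <= n)%N.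
Proof.
move=> uF /choice[a uE].
pose A : 'M[R[i]]_(m, n) := \matrix_(i, j) a i j.
suff fA : row_free A by rewrite -(eqP fA) rank_leq_col.
apply: inj_row_free => x xA0; apply/rowP => i; rewrite mxE.
apply: (uF (fun i => x 0 i)).
under eq_bigr do rewrite uE scaler_sumr.
rewrite exchange_big/= big1// => j _.
under eq_bigr do rewrite scalerA.
rewrite -scaler_suml; have /rowP/(_ j) := xA0; rewrite !mxE => xA0j.
rewrite (eq_bigr (fun k => x 0 k * A k j)) ?xA0j ?scale0r// => k _.
by rewrite mxE.
Qed.

Lemma has_dim_free W m n (u : 'I_m -> H) : has_dim W n -> free_family u ->
  (forall i, W (u i)) -> (m <= n)%N.
Proof.
move=> [v [_ _ vS]] uF uW; apply: (free_family_leq (v := v) uF) => i.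
by have [c /subr0_eq ->] := vS _ (uW i); exists c.
Qed.

Lemma linear_subspace_sum W I (r : seq I) (P : pred I) (c : I -> R[i]) (v : I -> H) :
  linear_subspace W -> (forall i, P i -> W (v i)) ->
  W (\sum_(i <- r | P i) c i *: v i).
Proof.
move=> [W0 WL] Wv; elim/big_rec : _ => // i x Pi Wx; exact: WL (Wv _ Pi) Wx.
Qed.

Lemma linear_subspace_range p : linear_subspace (range p).
Proof.
split; first by exists 0; rewrite ?linear0.
by move=> a _ _ [x _ <-] [y _ <-]; exists (a *: x + y); rewrite ?linearP.
Qed.

Lemma linear_subspace_kernel p : linear_subspace (Defs.kernel p).
Proof.
split; first by rewrite /Defs.kernel/= linear0.
by move=> a x y /= px py; rewrite /Defs.kernel/= linearD linearZ/= px py scaler0 addr0.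
Qed.

Lemma infinite_free W n : linear_subspace W -> infinite_dimensional W ->
  exists2 v : 'I_n -> H, free_family v & forall i, W (v i).
Proof.
move=> sW iW; elim: n => [|n [v vF vW]].
  by exists (fun=> 0); [move=> c _ []|case].
have [x [Wx xv]] : exists x, W x /\ forall c : 'I_n -> R[i], x <> \sum_i c i *: v i.
  apply: contrapT => nx; apply: iW; exists n, v; split => // x Wx.
  apply: contrapT => xc; apply: nx; exists x; split => // c xE.
  by apply: xc; exists c; rewrite -xE subrr.
exists (fun i => oapp v x (unlift ord_max i)) => [c|i]; last by case: unliftP => [j|] _ /=.
rewrite big_ord_recr/= unlift_none/=.
have -> : \sum_(i < n) c (widen_ord (leqnSn n) i) *:
    oapp v x (unlift ord_max (widen_ord (leqnSn n) i)) =
    \sum_(i < n) c (lift ord_max i) *: v i.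
  apply: eq_bigr => i _; have -> : widen_ord (leqnSn n) i = lift ord_max i.
    by apply/val_inj; rewrite /= /bump leqNgt ltn_ord.
  by rewrite liftK.
move=> c0; have [cm|cm] := eqVneq (c ord_max) 0.
  rewrite cm scale0r addr0 in c0 => i.
  by case: (unliftP ord_max i) => [j|] -> //; exact: (vF (fun j => c (lift ord_max j))).
exfalso; apply: (xv (fun i => - (c ord_max)^-1 * c (lift ord_max i))).
under eq_bigr do rewrite -scalerA.
rewrite -scaler_sumr; move: c0 => /eqP; rewrite addrC addr_eq0 => /eqP c0.
by rewrite scaleNr -scalerN -c0 scalerA mulVf// scale1r.
Qed.

(** With one more free vector than there are orthogonality conditions, the matrix of inner products
    has a nonzero left kernel. *)
Lemma infinite_perp W (l : seq H) : linear_subspace W -> infinite_dimensional W ->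
  exists u, [/\ W u, nrm u = 1 & forall z, z \in l -> inner u z = 0 :> R[i]].
Proof.
move=> sW iW; have [v vF vW] := infinite_free (size l).+1 sW iW.
pose A : 'M[R[i]]_((size l).+1, size l) := \matrix_(i, j) inner (v i) (l`_j).
have : kermx A != 0.
  rewrite kermx_eq0; apply/negP => /eqP rA.
  by have := rank_leq_col A; rewrite rA ltnn.
move=> /rowV0Pn[c /sub_kermxP cA c0].
pose x := \sum_i c 0 i *: v i.
have x0 : x != 0.
  apply: contra_neq c0 => x0; apply/rowP => i; rewrite mxE.
  exact: (vF (fun i => c 0 i)).
exists ((nrm x)^-1%:C *: x); split.
- rewrite -[_ *: _]addr0; apply: sW.2; last exact: sW.1.
  exact: linear_subspace_sum.
- by rewrite nrmZ nrm_pos ?invr_ge0 ?nrm_ge0// mulVf// gt_eqF// nrm_gt0.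
- move=> z zl; rewrite innerZl; apply/eqP; rewrite mulf_eq0; apply/orP; right.
  have zl' : (index z l < size l)%N by rewrite index_mem.
  have /rowP/(_ (Ordinal zl')) := cA; rewrite !mxE => <-.
  apply/eqP; rewrite inner_suml; apply: eq_bigr => i _.
  by rewrite mxE/= nth_index// innerZl.
Qed.

(** If q' s = s and q s = 0, then (q' - q) s = s forces s = 0. So q is injective on the range of q'
    and maps free families there to free families. *)
Lemma oproj_near_dim p p' n : is_orthoproj p -> is_orthoproj p' -> nrm (p - p') < 1 ->
  has_dim (range p) n -> has_dim (range p') n.
Proof.
move=> pp pp' pp1 dp.
have le q q' m k (u : 'I_m -> H) : is_orthoproj q -> is_orthoproj q' ->
    nrm (q - q') < 1 -> has_dim (range q) k -> free_family u ->
    (forall i, range q' (u i)) -> (m <= k)%N.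
  move=> pq pq' qq dq uF uq'.
  apply: (has_dim_free (u := q \o u)) dq _ _; last by move=> i; exists (u i).
  move=> c cu; apply: uF; apply: (nrm_op_lt1_eq0 (T := q' - q)); first by rewrite nrmC.
  rewrite opB; set s := \sum_i _.
  have -> : q s = 0.
    by rewrite -cu raddf_sum/=; apply: eq_bigr => i _; rewrite linearZ.
  rewrite subr0; apply/(oprojP _ pq'); apply: linear_subspace_sum => //.
  exact: linear_subspace_range.
(* Finiteness comes first: otherwise n + 1 free vectors in the range of p' would contradict the
   comparison. *)
have [m dm] : exists m, has_dim (range p') m.
  apply: contrapT => id'.
  have [v vF vW] := infinite_free n.+1 (linear_subspace_range p') id'.
  by have := le p p' _ n v pp pp' pp1 dp vF vW; rewrite ltnn.
suff -> : n = m by [].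
apply/eqP; rewrite eqn_leq; apply/andP; split.
  have [v [vp vF _]] := dp.
  by apply: (le p' p _ _ v) => //; rewrite nrmC.
have [v [vp vF _]] := dm.
by apply: (le p p' _ _ v).
Qed.

Lemma oproj_near_infinite p p' : is_orthoproj p -> is_orthoproj p' ->
  nrm (p - p') < 1 -> infinite_dimensional (range p) -> infinite_dimensional (range p').
Proof.
move=> pp pp' pp1 ip [n dn]; apply: ip; exists n.
by apply: oproj_near_dim dn => //; rewrite nrmC.
Qed.

(** In an infinite-dimensional range there is a unit vector orthogonal to all centres of a finite
    1-net, hence at distance at least 1 from each of them. *)
Lemma compact_oproj_finite p : is_orthoproj p -> compact_op p ->
  exists n, has_dim (range p) n.
Proof.
move=> pp /compact_op_totally_bounded/(_ 1 ltr01)[l _ lP]; apply: contrapT => ip.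
have [u [pu u1 ul]] := infinite_perp [seq p z | z <- l] (linear_subspace_range p) ip.
have [|z zl] := lP u; first by rewrite u1.
apply/negP; rewrite -leNgt -(@ler_sqr _ 1) ?nnegrE ?nrm_ge0//.
have {}pu : p u = u by exact/(oprojP _ pp).
rewrite nrm_sqrD_orth ?pu ?nrmN ?u1 ?lerDl ?sqr_ge0//.
by rewrite innerNr ul ?oppr0// map_f.
Qed.

(** Indexing by a predicate lets finite families, sequences and subsequences share one theory; the
    values of e off I are arbitrary. *)
Definition onf (I : pred nat) e :=
  forall i j, I i -> I j -> inner (e i) (e j) = (i == j)%:R :> R[i].

Definition upd e n u i := if i == n then u else e i.

Lemma updE e n u : upd e n u n = u. Proof. by rewrite /upd eqxx. Qed.

Lemma upd_lt e n u i : (i < n)%N -> upd e n u i = e i.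
Proof. by move=> i_n; rewrite /upd ltn_eqF. Qed.

Definition fsum n e x := \sum_(i < n) (inner x (e i) : R[i]) *: e i.

Lemma fsum_eq n e e' x : (forall i, (i < n)%N -> e i = e' i) -> fsum n e x = fsum n e' x.
Proof. by move=> ee'; apply: eq_bigr => i _; rewrite ee'. Qed.

Lemma onf_coord n e (c : 'I_n -> R[i]) (j : 'I_n) : onf (fun i => (i < n)%N) e ->
  inner (\sum_(i < n) c i *: e i) (e j) = c j.
Proof.
move=> oe; rewrite inner_suml (bigD1 j)//= big1 ?addr0 => [|i ij].
  by rewrite innerZl oe// eqxx mulr1.
by rewrite innerZl oe// (_ : (i == j :> nat) = false) ?mulr0//; exact/negbTE.
Qed.

Lemma fsum_orth n e x j : onf (fun i => (i < n)%N) e -> (j < n)%N ->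
  inner (x - fsum n e x) (e j) = 0 :> R[i].
Proof.
move=> oe jn; rewrite innerBl.
by rewrite (onf_coord (fun i => inner x (e i)) (Ordinal jn) oe)/= subrr.
Qed.

Lemma onf_free n e : onf (fun i => (i < n)%N) e -> free_family (fun i : 'I_n => e i).
Proof. by move=> oe c c0 i; rewrite -(onf_coord c i oe) c0 inner0l. Qed.

Lemma onfS n e u : onf (fun i => (i < n)%N) e -> nrm u = 1 ->
  (forall i, (i < n)%N -> inner u (e i) = 0 :> R[i]) ->
  onf (fun i => (i < n.+1)%N) (upd e n u).
Proof.
move=> oe u1 ue i j; rewrite !ltnS /upd.
have [->|ni] := eqVneq i n; have [->|nj] := eqVneq j n; rewrite ?eqxx.
- by rewrite inner_nrm u1 expr1n.
- move=> _ jn; have {}jn : (j < n)%N by rewrite ltn_neqAle nj.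
  by rewrite ue// eq_sym (negbTE nj).
- move=> i_n _; have {}i_n : (i < n)%N by rewrite ltn_neqAle ni.
  by rewrite innerC ue// conjC0 (negbTE ni).
- by move=> i_n jn; rewrite oe// ltn_neqAle ?ni ?nj.
Qed.

Lemma gram_schmidt_step W n e x : linear_subspace W ->
  onf (fun i => (i < n)%N) e -> (forall i, (i < n)%N -> W (e i)) -> W x ->
  x <> fsum n e x ->
  exists u, [/\ W u, nrm u = 1, forall i, (i < n)%N -> inner u (e i) = 0 :> R[i] &
    x = fsum n e x + inner x u *: u].
Proof.
move=> sW oe We Wx xe; pose r := x - fsum n e x.
have r0 : r != 0 by apply/eqP => /subr0_eq.
have nr0 : (nrm r)%:C != 0 :> R[i].
  by rewrite (inj_eq (@complexI R)) gt_eqF// nrm_gt0.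
have ro i : (i < n)%N -> inner r (e i) = 0 :> R[i] by exact: fsum_orth.
exists ((nrm r)^-1%:C *: r); split.
- rewrite -[_ *: _]addr0; apply: sW.2; last exact: sW.1.
  rewrite /r addrC -scaleN1r; apply: sW.2 => //.
  by apply: linear_subspace_sum => // i _; exact: We.
- by rewrite nrmZ nrm_pos ?invr_ge0 ?nrm_ge0// mulVf// gt_eqF// nrm_gt0.
- by move=> i i_n; rewrite innerZl ro// mulr0.
- have xr : inner x r = (nrm r ^+ 2)%:C.
    rewrite -inner_nrm -[in LHS](subrK (fsum n e x) x) innerDl.
    rewrite -/r [X in _ + X](_ : _ = 0) ?addr0//.
    rewrite innerC inner_sumr big1 ?conjC0// => i _.
    by rewrite innerZr ro// mulr0.
  rewrite innerZr xr conj_real scalerA -!rmorphM/= expr2 mulrA mulVf ?mul1r.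
    by rewrite mulfV ?scale1r ?subrKC// gt_eqF// nrm_gt0.
  by rewrite gt_eqF// nrm_gt0.
Qed.

Lemma finite_onb W n : linear_subspace W -> has_dim W n ->
  exists e, [/\ onf (fun i => (i < n)%N) e, forall i, (i < n)%N -> W (e i) &
    forall x, W x -> x = fsum n e x].
Proof.
move=> sW dW.
have ex k : (k <= n)%N -> exists e, onf (fun i => (i < k)%N) e /\
    forall i, (i < k)%N -> W (e i).
  elim: k => [|k IH] kn; first by exists (fun=> 0); split.
  have [e [oe We]] := IH (ltnW kn).
  have [x [Wx xe]] : exists x, W x /\ x <> fsum k e x.
    apply: contrapT => nx; have [v [vW vF _]] := dW.
    have : (n <= k)%N.
      apply: (free_family_leq (u := v) (v := fun i : 'I_k => e i)) => // i.
      exists (fun j => inner (v i) (e j)); apply: contrapT => vi.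
      by apply: nx; exists (v i).
    by rewrite leqNgt kn.
  have [u [Wu u1 ue _]] := gram_schmidt_step sW oe We Wx xe.
  exists (upd e k u); split; first exact: onfS.
  move=> i; rewrite ltnS leq_eqVlt => /predU1P[->|ik]; first by rewrite updE.
  by rewrite upd_lt//; exact: We.
have [e [oe We]] := ex n (leqnn n).
exists e; split => // x Wx; apply: contrapT => xe.
have [u [Wu u1 ue _]] := gram_schmidt_step sW oe We Wx xe.
have := has_dim_free dW (onf_free (onfS oe u1 ue)).
rewrite ltnn => /(_ _)/notF; apply => -[i /=].
rewrite ltnS leq_eqVlt => /predU1P[->|ik]; first by rewrite updE.
by rewrite upd_lt//; exact: We.
Qed.

(** Dependent choice with conditions on the whole past: the first hypothesis expresses that
    [P n e u] sees only the first n terms of e. *)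
Lemma sequence_rec (P : nat -> (nat -> H) -> H -> Prop) :
  (forall n e e' u, (forall i, (i < n)%N -> e i = e' i) -> P n e u -> P n e' u) ->
  (forall n e, (forall i, (i < n)%N -> P i e (e i)) -> exists u, P n e u) ->
  exists e, forall n, P n e (e n).
Proof.
move=> Pext Pex.
have /choice[F FP] (ne : nat * (nat -> H)) : exists u,
    (forall i, (i < ne.1)%N -> P i ne.2 (ne.2 i)) -> P ne.1 ne.2 u.
  have [h|h] := pselect (forall i, (i < ne.1)%N -> P i ne.2 (ne.2 i)).
    by have [u Pu] := Pex _ _ h; exists u.
  by exists 0.
(* [E n] holds the first n terms and 0 beyond; the sequence itself is read off the diagonal. *)
pose E := fix E n := if n is m.+1 then upd (E m) m (F (m, E m)) else fun=> 0.
pose e n := E n.+1 n.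
have Ee n i : (i < n)%N -> E n i = e i.
  elim: n => // n IH; rewrite ltnS leq_eqVlt => /predU1P[->//|i_n].
  by rewrite /= upd_lt// IH.
exists e; elim/ltn_ind => n IH.
apply: (Pext _ (E n)) => [i /Ee//|].
rewrite /e /= updE; apply: (FP (n, E n)) => i i_n /=.
rewrite Ee//; apply: (Pext _ e); last exact: IH.
by move=> j ji; rewrite Ee// (ltn_trans ji).
Qed.

Lemma onfP e : (forall i, nrm (e i) = 1) ->
  (forall n i, (i < n)%N -> inner (e n) (e i) = 0 :> R[i]) -> onf predT e.
Proof.
move=> e1 eo i j _ _; have [ij|ji|->] := ltngtP i j.
- by rewrite innerC eo// conjC0.
- by rewrite eo.
- by rewrite inner_nrm e1 expr1n.
Qed.

Lemma gram_schmidt W (y : nat -> H) : linear_subspace W -> infinite_dimensional W ->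
  (forall j, W (y j)) ->
  exists e, [/\ onf predT e, forall i, W (e i) & forall j, y j = fsum j.+1 e (y j)].
Proof.
move=> sW iW Wy.
have [] := @sequence_rec (fun n e u => [/\ W u, nrm u = 1,
    forall i, (i < n)%N -> inner u (e i) = 0 :> R[i] &
    y n = fsum n e (y n) + inner (y n) u *: u]).
- move=> n e e' u ee' [Wu u1 ue yE]; split => //.
    by move=> i i_n; rewrite -ee'// ue.
  by rewrite -(fsum_eq _ ee').
- move=> n e eP.
  have oe : onf (fun i => (i < n)%N) e.
    move=> i j i_n jn; have [ij|ji|->] := ltngtP i j.
    + by rewrite innerC; have [_ _ -> //] := eP _ jn; rewrite conjC0.
    + by have [_ _ -> //] := eP _ i_n.
    + by rewrite inner_nrm; have [_ -> _ _] := eP _ jn; rewrite expr1n.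
  have We i : (i < n)%N -> W (e i) by move=> /eP[].
  have [yn|yn] := pselect (y n = fsum n e (y n)); last exact: gram_schmidt_step.
  (* Here y_n adds nothing to the span. A fresh vector orthogonal to y_n as well keeps the sequence
     infinite and the expansion valid, with coefficient 0. *)
  have [u [Wu u1 ue]] := infinite_perp (y n :: mkseq e n) sW iW.
  exists u; split => //.
    move=> i i_n; rewrite ue// in_cons; apply/orP; right.
    by apply/mapP; exists i; rewrite ?mem_iota.
  by rewrite [inner (y n) u]innerC ue ?mem_head// conjC0 scale0r addr0.
move=> e eP; exists e; split.
- by apply: onfP => [i|n i i_n]; [have [] := eP i|have [_ _ ->] := eP n].
- by move=> i; have [] := eP i.
- by move=> j; rewrite {1}/fsum big_ord_recr/=; have [] := eP j.
Qed.

(** One orthonormal sequence is built with even terms in W and odd terms in W', which makes its two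
    halves mutually orthogonal. *)
Lemma interleaved_onf (W W' : set H) : linear_subspace W -> infinite_dimensional W ->
  linear_subspace W' -> infinite_dimensional W' ->
  exists e f, [/\ onf predT e, onf predT f, forall i, W (e i), forall i, W' (f i) &
    forall i j, inner (e i) (f j) = 0 :> R[i]].
Proof.
move=> sW iW sW' iW'.
have [] := @sequence_rec (fun n e u => [/\ (if odd n then W' else W) u, nrm u = 1 &
    forall i, (i < n)%N -> inner u (e i) = 0 :> R[i]]).
- move=> n e e' u ee' [Wu u1 ue]; split => // i i_n.
  by rewrite -ee'// ue.
- move=> n e _.
  have [||u [Wu u1 ue]] := @infinite_perp (if odd n then W' else W) (mkseq e n).
  + by case: ifP.
  + by case: ifP.
  exists u; split => // i i_n.
  by rewrite ue//; apply/mapP; exists i; rewrite ?mem_iota.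
move=> g gP.
have og : onf predT g.
  by apply: onfP => [i|n i i_n]; [have [_ g1 _] := gP i|have [_ _ ->] := gP n].
exists (fun i => g i.*2), (fun i => g i.*2.+1); split.
- by move=> i j _ _; rewrite og// (inj_eq double_inj).
- by move=> i j _ _; rewrite og// eqSS (inj_eq double_inj).
- by move=> i; have [+ _ _] := gP i.*2; rewrite odd_double.
- by move=> i; have [+ _ _] := gP i.*2.+1; rewrite /= odd_double.
- move=> i j; rewrite og// (_ : (i.*2 == j.*2.+1) = false)//.
  by apply/negP => /eqP/(congr1 odd); rewrite /= !odd_double.
Qed.

End dimension.

(** * Partial isometries between orthonormal families *)

Section shifts.
Context {R : realType} {H : hilbertType R}.
Implicit Types (I J : pred nat) (e f g : nat -> H) (x y z : H) (S T p P : bounded_op H).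

Lemma converges_unique (u : nat -> H) x y : converges u x -> converges u y -> x = y.
Proof.
move=> ux uy; apply/subr0_eq/nrm_eq0/le_anti; rewrite nrm_ge0 andbT.
apply/ler_addgt0Pr => d d0; rewrite add0r.
have d20 : 0 < d / 2 by rewrite divr_gt0.
have [N uN] := ux _ d20; have [M uM] := uy _ d20.
rewrite (le_trans (nrm_triangle (u (maxn N M)) _ _))// (splitr d) lerD//.
  by rewrite nrmC ltW// uN// leq_maxl.
by rewrite ltW// uM// leq_maxr.
Qed.

Lemma converges_cst (u : nat -> H) x :
  (exists N, forall n, (N <= n)%N -> u n = x) -> converges u x.
Proof.
by move=> [N uN] d d0; exists N => n Nn; rewrite uN// subrr nrm0.
Qed.

Lemma converges_linear (u v : nat -> H) (a : R[i]) x y : converges u x ->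
  converges v y -> converges (fun n => a *: u n + v n) (a *: x + y).
Proof.
move=> ux vy d d0.
have a0 : 0 < nrm a + 1 by rewrite ltr_wpDl// nrm_ge0.
have d20 : 0 < d / 2 by rewrite divr_gt0.
have [N uN] := ux _ (divr_gt0 d20 a0); have [M vM] := vy _ d20.
exists (maxn N M) => n; rewrite geq_max => /andP[/uN un /vM vn].
rewrite opprD addrACA -scalerBr (le_lt_trans (nrmD _ _))// (splitr d) ltrD//.
rewrite nrmZ; move: un; rewrite ltr_pdivlMr// mulrC; apply: le_lt_trans.
by rewrite ler_wpM2r ?nrm_ge0// lerDl.
Qed.

Lemma converges_adj (u v : nat -> H) x y a b : converges u x -> converges v y ->
  (forall n, inner (u n) b = inner a (v n) :> R[i]) -> inner x b = inner a y :> R[i].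
Proof.
move=> ux vy uv; apply/subr0_eq/nrm_eq0/le_anti; rewrite nrm_ge0 andbT.
apply/ler_addgt0Pr => d d0; rewrite add0r.
have k0 : 0 < nrm a + nrm b + 1 by rewrite ltr_wpDl// addr_ge0 ?nrm_ge0.
have [N uN] := ux _ (divr_gt0 d0 k0); have [M vM] := vy _ (divr_gt0 d0 k0).
have /ltW hu := uN (maxn N M) (leq_maxl _ _).
have /ltW hv := vM (maxn N M) (leq_maxr _ _).
set n := maxn N M in hu hv.
have -> : inner x b - inner a y = inner (x - u n) b + inner a (v n - y) :> R[i].
  by rewrite innerBl innerBr uv addrA subrK.
rewrite (le_trans (nrmD _ _))// (le_trans (lerD (inner_le _ _) (inner_le _ _)))//.
rewrite (nrmC x) (le_trans (lerD (ler_wpM2r (nrm_ge0 b) hu) (ler_wpM2l (nrm_ge0 a) hv)))//.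
rewrite [leLHS](_ : _ = d * ((nrm a + nrm b) / (nrm a + nrm b + 1))); last by ring.
by rewrite ler_piMr ?(ltW d0)// ler_pdivrMr// mul1r lerDl.
Qed.

Definition psum I e f n x := \sum_(0 <= i < n | I i) (inner x (e i) : R[i]) *: f i.

Lemma onf_pythagoras I f m n (c : nat -> R[i]) : onf I f ->
  nrm (\sum_(m <= i < n | I i) c i *: f i) ^+ 2 = \sum_(m <= i < n | I i) nrm (c i) ^+ 2.
Proof.
move=> of_; elim: n => [|n IH]; first by rewrite !big_geq// nrm0 expr0n.
have [mn|nm] := leqP m n; last by rewrite !big_geq// nrm0 expr0n.
rewrite big_mkcond big_nat_recr//= -big_mkcond/=.
rewrite [RHS]big_mkcond big_nat_recr//= -[X in _ = X + _]big_mkcond/= -IH.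
case: ifPn => [In|_]; last by rewrite !addr0.
rewrite nrm_sqrD_orth; last first.
  rewrite innerZr inner_suml big_nat_cond big1 ?mulr0// => i /andP[/andP[_ i_n] Ii].
  by rewrite innerZl of_// ltn_eqF// mulr0.
congr (_ + _); rewrite nrmZ exprMn -[X in _ * X](@nrm_pos R) ?sqr_ge0//.
by rewrite -inner_nrm of_// eqxx nrm1 mulr1.
Qed.

Lemma psum_coord I e f n x j : onf I f -> I j ->
  inner (psum I e f n x) (f j) = (if (j < n)%N then inner x (e j) else 0) :> R[i].
Proof.
move=> of_ Ij; rewrite /psum inner_suml big_mkord.
case: ifPn => [jn|jn].
  rewrite (bigD1 (Ordinal jn))//= big1 ?addr0 => [|i /andP[Ii ij]].
    by rewrite innerZl of_// eqxx mulr1.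
  by rewrite innerZl of_// (_ : (i == j :> nat) = false) ?mulr0//; exact/negbTE.
rewrite big1// => i Ii; rewrite innerZl of_// (_ : (i == j :> nat) = false) ?mulr0//.
by apply: contraNF jn => /eqP <-.
Qed.

Lemma bessel I e n x : onf I e ->
  \sum_(0 <= i < n | I i) nrm (inner x (e i) : R[i]) ^+ 2 <= nrm x ^+ 2.
Proof.
move=> oe; rewrite -(onf_pythagoras _ _ _ oe).
rewrite -[X in _ <= nrm X ^+ 2](subrK (psum I e e n x)) addrC nrm_sqrD_orth.
  by rewrite lerDl sqr_ge0.
rewrite /psum inner_suml big_nat_cond big1// => i /andP[/andP[_ i_n] Ii].
rewrite innerZl innerBr; apply/eqP; rewrite mulf_eq0 subr_eq0; apply/orP; right.
by rewrite [inner _ (psum _ _ _ _ _)]innerC psum_coord// i_n -innerC.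
Qed.

(** The sums of |<x, e_i>|^2 increase and are bounded by Bessel's inequality; their increments are
    squared distances between the partial sums of vectors, which are therefore Cauchy. *)
Lemma psum_converges I e f x : onf I e -> onf I f ->
  exists y, converges (fun n => psum I e f n x) y.
Proof.
move=> oe of_; apply: hilbert_complete => d d0.
pose B n := \sum_(0 <= i < n | I i) nrm (inner x (e i) : R[i]) ^+ 2.
have sB : has_sup (range B).
  split; first by exists (B 0%N), 0%N.
  by exists (nrm x ^+ 2) => _ [n _ <-]; exact: bessel.
have addDK (V : zmodType) (a b : V) : a + b - a = b by rewrite addrC addKr.
have [_ [N _ <-] BN] := sup_adherent (exprn_gt0 2 d0) sB.
exists N => m n Nm mn.
have BE : B n - B m = nrm (psum I e f n x - psum I e f m x) ^+ 2.
  rewrite /B /psum (big_cat_nat (leq0n m) mn)/=.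
  rewrite [X in nrm (X - _)](big_cat_nat (leq0n m) mn)/=.
  rewrite !addDK.
  by rewrite onf_pythagoras.
rewrite -ltr_sqr ?nnegrE ?nrm_ge0 ?ltW// -BE.
have Bn : B n <= sup (range B) by apply: ub_le_sup; [exact: sB.2|exists n].
have Bm : B N <= B m.
  rewrite /B [leRHS](big_cat_nat (leq0n N) Nm)/= lerDl sumr_ge0// => i _.
  exact: sqr_ge0.
by lra.
Qed.

(* S x is the sum over i in I of <x, e_i> f_i. *)
Definition shift S I e f := [/\ onf I e, onf I f &
  forall x, converges (fun n => psum I e f n x) (S x)].

Lemma shift_exists I e f : onf I e -> onf I f -> exists S, shift S I e f.
Proof.
move=> oe of_; have [S0 S0P] := choice (fun x => psum_converges x oe of_).
have [|x|S SE] := @op_build _ _ S0 1.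
- move=> a x y; apply: converges_unique (S0P _) _.
  suff -> : psum I e f ^~ (a *: x + y) =
      (fun n => a *: psum I e f n x + psum I e f n y).
    exact: converges_linear.
  apply/funext => n; rewrite /psum scaler_sumr -big_split/=.
  by apply: eq_bigr => i _; rewrite innerDl innerZl scalerDl scalerA.
- apply: converges_le (S0P x) _; exists 0%N => n _.
  rewrite mul1r -ler_sqr ?nnegrE ?nrm_ge0// onf_pythagoras//.
  exact: bessel.
by exists S; split => // x; rewrite SE.
Qed.

Lemma shift_adj S T I e f : shift S I e f -> shift T I f e -> adj S T.
Proof.
move=> [oe of_ hS] [_ _ hT] x y; apply: converges_adj (hS x) (hT y) _ => n.
rewrite /psum inner_suml inner_sumr; apply: eq_bigr => i _.
by rewrite innerZl innerZr -innerC mulrC.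
Qed.

Lemma shift_coord S I e f x j : shift S I e f -> I j ->
  inner (S x) (f j) = inner x (e j) :> R[i].
Proof.
move=> [oe of_ hS] Ij; apply: converges_inner (hS x) _.
by exists j.+1 => n jn; rewrite psum_coord// jn.
Qed.

Lemma shift_perp S I e f x y : shift S I e f ->
  (forall i, I i -> inner (f i) y = 0 :> R[i]) -> inner (S x) y = 0 :> R[i].
Proof.
move=> [_ _ hS] fy; apply: converges_inner (hS x) _; exists 0%N => n _.
by rewrite /psum inner_suml big1// => i Ii; rewrite innerZl fy// mulr0.
Qed.

Lemma shift_eq0 S I e f x : shift S I e f ->
  (forall i, I i -> inner x (e i) = 0 :> R[i]) -> S x = 0.
Proof.
move=> [_ _ hS] xe; apply: converges_unique (hS x) _.
apply: converges_cst; exists 0%N => n _.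
by rewrite /psum big1// => i Ii; rewrite xe// scale0r.
Qed.

(** S x - T y is a limit of combinations of the f_j with j in I or J. Being orthogonal to all of
    these, it is orthogonal to itself. *)
Lemma shift_ext S T I J e e' f x y : shift S I e f -> shift T J e' f ->
  (forall j, I j || J j -> inner (S x) (f j) = inner (T y) (f j) :> R[i]) -> S x = T y.
Proof.
move=> hS hT ST; apply/subr0_eq/inner_eq0.
have fw j : I j || J j -> inner (f j) (S x - T y) = 0 :> R[i].
  by move=> IJ; rewrite innerC innerBl ST// subrr conjC0.
rewrite innerBl (shift_perp _ hS) => [|i Ii]; last by rewrite fw// Ii.
by rewrite (shift_perp _ hT) ?subrr// => i Ji; rewrite fw// Ji orbT.
Qed.

Lemma shift_basis S I e f j : shift S I e f -> I j -> S (e j) = f j.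
Proof.
move=> [oe of_ hS] Ij; apply: converges_unique (hS _) _; apply: converges_cst.
exists j.+1 => n jn; rewrite /psum big_mkord (bigD1 (Ordinal jn))//= big1 => [|i /andP[Ii ij]].
  by rewrite addr0 oe// eqxx scale1r.
by rewrite oe// (_ : (j == i :> nat) = false) ?scale0r// eq_sym; exact/negbTE.
Qed.

(** Since I may be smaller than J, a single shift over all indices can be cut down to any set of
    indices by a projection. *)
Lemma shift_comp S T U I J e f g : {subset I <= J} ->
  shift S I e f -> shift T J f g -> shift U I e g -> T * S = U.
Proof.
move=> IJ hS hT hU; apply: op_ext => x; apply: (shift_ext hT hU) => j.
have [of_ og _] := hT.
move=> /orP Jj; have {}Jj : J j by case: Jj => // /IJ.
rewrite (shift_coord _ hT)//; have [Ij|nIj] := boolP (I j).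
  by rewrite (shift_coord _ hS)// (shift_coord _ hU).
have ne i : I i -> (i == j) = false by move=> Ii; apply: contraNF nIj => /eqP <-.
rewrite (shift_perp _ hS) => [|i Ii]; last by rewrite of_ ?ne//; exact: IJ.
by rewrite (shift_perp _ hU)// => i Ii; rewrite og ?ne//; exact: IJ.
Qed.

Lemma shift_oproj P I e : shift P I e e -> is_orthoproj P.
Proof. by move=> hP; split; [exact: (shift_comp _ hP hP hP)|exact: (shift_adj hP hP)]. Qed.

(** S^* S = P, because the adjoint of S is the reverse shift. *)
Lemma shift_nrm S P I e f x : shift S I e f -> shift P I e e -> nrm (S x) = nrm (P x).
Proof.
move=> hS hP; have [oe of_ _] := hS; have [T hT] := shift_exists of_ oe.
apply/eqP; rewrite -(@eqrXn2 _ 2) ?nrm_ge0// !nrm_sqr (shift_adj hS hT) -opM.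
have pP := shift_oproj hP.
by rewrite (shift_comp _ hS hT hP)// (oproj_adj pP) oproj_fix.
Qed.

Lemma shift_mull p S I e f : shift S I e f -> is_orthoproj p ->
  (forall i, I i -> p (f i) = f i) -> p * S = S.
Proof.
move=> hS pp pf; apply: op_ext => x; apply: inner_ext => y.
rewrite opM (oproj_adj pp); apply/eqP; rewrite -subr_eq0 -innerBr; apply/eqP.
by apply: shift_perp hS _ => i Ii; rewrite innerBr -(oproj_adj pp) pf// subrr.
Qed.

(** p - P is a projection whose range lies in that of p and is orthogonal to every e_i, so that
    completeness of the family makes it vanish. *)
Lemma shift_oprojE p P I e : shift P I e e -> is_orthoproj p ->
  (forall i, I i -> p (e i) = e i) ->
  (forall x, p x = x -> (forall i, I i -> inner x (e i) = 0 :> R[i]) -> x = 0) ->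
  p = P.
Proof.
move=> hP pp pe p0; have pP := shift_mull hP pp pe.
have pPo := oproj_sub pp (shift_oproj hP) pP.
apply/subr0_eq/op_ext => x; apply: p0 => [|i Ii].
  by rewrite -opM mulrBr pP oproj_idem.
by rewrite (oproj_adj pPo) opB pe// (shift_basis hP)// subrr inner0r.
Qed.

Lemma shift_finite S n e f x : shift S (fun i => (i < n)%N) e f ->
  S x = \sum_(i < n) (inner x (e i) : R[i]) *: f i.
Proof.
move=> [_ _ hS]; apply: converges_unique (hS x) _; apply: converges_cst.
exists n => m nm; rewrite /psum (big_cat_nat (leq0n n) nm)/= [X in _ + X]big_nat_cond.
rewrite [X in _ + X]big1 ?addr0; last first.
  by move=> i /andP[/andP[+ _] +]; rewrite leqNgt => /negP.
by rewrite big_mkord; apply: eq_bigl => i; rewrite ltn_ord.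
Qed.

Lemma finite_rank_compact n e f S :
  (forall x, S x = \sum_(i < n) (inner x (e i) : R[i]) *: f i) -> compact_op S.
Proof.
elim: n S => [|n IH] S SE.
  rewrite (_ : S = 0); first exact: compact_op0.
  by apply: op_ext => x; rewrite SE big_ord0.
have [|x|T TE] := @op_build _ _ (fun x => (inner x (e n) : R[i]) *: f n) (nrm (e n) * nrm (f n)).
- by move=> a x y; rewrite innerDl innerZl scalerDl scalerA.
- by rewrite nrmZ mulrAC [nrm (e n) * _]mulrC ler_wpM2r ?nrm_ge0// inner_le.
rewrite -(subrK T S); apply: compact_opD.
  by apply: IH => x; rewrite opB SE TE big_ord_recr/= addrK.
by apply: (@rank1_compact _ _ _ (f n)) => x; exists (inner x (e n)); rewrite TE.
Qed.

Lemma shift_compact S n e f : shift S (fun i => (i < n)%N) e f -> compact_op S.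
Proof. by move=> hS; apply: (@finite_rank_compact n e f) => x; exact: shift_finite. Qed.

Lemma shift_has_dim P n e : shift P (fun i => (i < n)%N) e e -> has_dim (range P) n.
Proof.
move=> hP; have [oe _ _] := hP; have pP := shift_oproj hP.
exists (fun i => e i); split.
- by move=> i; apply/(oprojP _ pP); rewrite (shift_basis hP).
- exact: onf_free.
- move=> x /(oprojP _ pP) Px; exists (fun i => inner x (e i)).
  by rewrite /= -(shift_finite x hP) Px subrr.
Qed.

Lemma finite_oproj_shift p n : is_orthoproj p -> has_dim (range p) n ->
  exists e, shift p (fun i => (i < n)%N) e e.
Proof.
move=> pp dp; have [e [oe pe eE]] := finite_onb (linear_subspace_range p) dp.
exists e; have [P hP] := shift_exists oe oe.
rewrite (shift_oprojE hP pp)//.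
  by move=> i /pe /(oprojP _ pp).
move=> x px xe; rewrite (eE x); last exact/(oprojP _ pp).
by rewrite /fsum big1// => i _; rewrite xe// scale0r.
Qed.

(** Gram-Schmidt is applied to the projections of a dense sequence d. A vector of the range
    orthogonal to every e_i is orthogonal to every d_j, and density forces it to be 0. *)
Lemma separable_onb p : separable_space H -> is_orthoproj p ->
  infinite_dimensional (range p) -> exists e, shift p predT e e.
Proof.
move=> [D cD dD] pp ip.
have [d dP] : exists d : nat -> H, D `<=` range d.
  have /pcard_geP/unsquash h := cD.
  by exists h => x Dx; have [n _ <-] := [elaborate 'surj_h] x Dx; exists n.
have pd j : range p (p (d j)) by exists (d j).
have [e [oe pe eE]] := gram_schmidt (linear_subspace_range p) ip pd.
exists e; have [P hP] := shift_exists oe oe.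
have {}pe i : p (e i) = e i by exact/(oprojP _ pp)/pe.
rewrite (shift_oprojE hP pp)// => x px xe.
have xd j : inner x (d j) = 0 :> R[i].
  rewrite -px (oproj_adj pp) eE /fsum inner_sumr big1// => i _.
  by rewrite innerZr xe// mulr0.
apply: contrapT => /eqP x0; have nx := nrm_gt0 x0.
have nx' : 0 < (nrm x)%:C :> R[i] by rewrite ltcR.
have xB : (ball x (nrm x)%:C)° !=set0.
  by exists x; apply: nbhs_singleton; exact/nbhs_interior/nbhsx_ballx.
have [y []] := dD _ xB (open_interior _).
move=> /interior_subset /ball_nrm xy /dP[j _ dj].
(* A vector orthogonal to x is at distance at least |x| from it, whereas y = d_j was chosen
   closer. *)
have : nrm x ^+ 2 <= nrm (x - y) ^+ 2.
  by rewrite nrm_sqrD_orth ?nrmN ?lerDl ?sqr_ge0// innerNr -dj xd oppr0.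
by rewrite ler_sqr ?nnegrE ?nrm_ge0// leNgt xy.
Qed.

End shifts.

(** * Reduction of the Fredholm index to a finite matrix *)

Section index.
Context {R : realType} {H : hilbertType R}.
Implicit Types (E F D M T : bounded_op H) (x y z : H).

(** The coefficients form a row vector, so that changes of family become matrix products. *)
Definition lincomb n (v : 'I_n -> H) (c : 'rV[R[i]]_n) := \sum_i c 0 i *: v i.

Lemma lincomb_mul m n (v : 'I_n -> H) (A : 'M[R[i]]_(m, n)) (c : 'rV[R[i]]_m) :
  lincomb (fun i => lincomb v (row i A)) c = lincomb v (c *m A).
Proof.
rewrite /lincomb; under eq_bigr do rewrite scaler_sumr.
rewrite exchange_big/=; apply: eq_bigr => j _.
rewrite mxE scaler_suml; apply: eq_bigr => i _.
by rewrite scalerA mxE.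
Qed.

Lemma lincomb_op T n (v : 'I_n -> H) (c : 'rV[R[i]]_n) :
  T (lincomb v c) = lincomb (T \o v) c.
Proof. by rewrite raddf_sum/=; apply: eq_bigr => i _; rewrite linearZ. Qed.

Lemma eq_lincomb n (v v' : 'I_n -> H) c : v =1 v' -> lincomb v c = lincomb v' c.
Proof. by move=> vv'; apply: eq_bigr => i _; rewrite vv'. Qed.

Lemma lincomb_row n (c : 'I_n -> R[i]) (v : 'I_n -> H) :
  \sum_i c i *: v i = lincomb v (\row_i c i).
Proof. by apply: eq_bigr => i _; rewrite mxE. Qed.

Lemma lincombD n (v : 'I_n -> H) c d : lincomb v (c + d) = lincomb v c + lincomb v d.
Proof.
by rewrite /lincomb -big_split/=; apply: eq_bigr => i _; rewrite mxE scalerDl.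
Qed.

Lemma lincombB n (v : 'I_n -> H) c d : lincomb v (c - d) = lincomb v c - lincomb v d.
Proof.
by rewrite /lincomb -sumrB; apply: eq_bigr => i _; rewrite !mxE scalerBl.
Qed.

Lemma lincombBv n (v w : 'I_n -> H) c :
  lincomb (fun i => v i - w i) c = lincomb v c - lincomb w c.
Proof.
by rewrite /lincomb -sumrB; apply: eq_bigr => i _; rewrite scalerBr.
Qed.

Lemma lincomb0 n (v : 'I_n -> H) : lincomb v 0 = 0.
Proof. by rewrite /lincomb big1// => i _; rewrite mxE scale0r. Qed.

Lemma lincomb_free n (v : 'I_n -> H) c : free_family v -> lincomb v c = 0 -> c = 0.
Proof.
by move=> vF c0; apply/rowP => i; rewrite mxE; exact: (vF (fun i => c 0 i)).
Qed.

(* E F restricts to a bijection from the range of D to that of M, so its kernel and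
   cokernel are those of an n x c matrix A. *)
Lemma has_fredholm_index_split E F D M n c :
  is_orthoproj E -> is_orthoproj F -> is_orthoproj D -> is_orthoproj M ->
  F * D = D -> E * M = M ->
  has_dim (range (F - D)) n -> has_dim (range (E - M)) c ->
  (forall x, D x = x -> E (F x) = 0 -> x = 0) ->
  (forall x, D x = x -> M (E (F x)) = E (F x)) ->
  (forall y, M y = y -> exists2 x, D x = x & E (F x) = y) ->
  has_fredholm_index (range F) (range E) (E * F : H -> H) (n%:Z - c%:Z).
Proof.
move=> pE pF pD pM FD EM [a [aW aF aS]] [b [bW bF bS]] inj sM onM.
have DF := oproj_mulC pF pD FD; have ME := oproj_mulC pE pM EM.
have FDx x : D x = x -> F x = x by move=> <-; rewrite -opM FD.
have EMx x : M x = x -> E x = x by move=> <-; rewrite -opM EM.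
have {}aW i : (F - D) (a i) = a i.
  exact/(oprojP _ (oproj_sub pF pD FD)).
have {}bW i : (E - M) (b i) = b i.
  exact/(oprojP _ (oproj_sub pE pM EM)).
have Da i : D (a i) = 0 by rewrite -aW opB raddfB/= -opM DF oproj_fix// subrr.
have Mb i : M (b i) = 0 by rewrite -bW opB raddfB/= -opM ME oproj_fix// subrr.
have Fa i : F (a i) = a i by rewrite -[in RHS]aW opB Da subr0.
have Eb i : E (b i) = b i by rewrite -[in RHS]bW opB Mb subr0.
(* The image of h_i, a vector of the range of D, is the M-component of E F a_i; subtracting h_i from
   a_i leaves a vector whose image lies in the range of E - M, the span of b. *)
have /choice[h hP] i : exists h, D h = h /\ E (F h) = M (E (F (a i))).
  by have [x Dx Tx] := onM (M (E (F (a i)))) (oproj_fix _ pM); exists x.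
pose a' i := a i - h i.
have Fa' i : F (a' i) = a' i by rewrite raddfB/= Fa (FDx _ (hP i).1).
have /choice[A0 A0P] i : exists c0 : 'I_c -> R[i], (E - M) (E (F (a i))) = \sum_j c0 j *: b j.
  have [|c0 /subr0_eq c0P] := bS ((E - M) (E (F (a i)))); first by exists (E (F (a i))).
  by exists c0.
pose A : 'M[R[i]]_(n, c) := \matrix_(i, j) A0 i j.
have Ta' i : E (F (a' i)) = lincomb b (row i A).
  rewrite /a' 2!raddfB/= (hP i).2; transitivity ((E - M) (E (F (a i)))).
    by rewrite opB oproj_fix.
  by rewrite A0P; apply: eq_bigr => j _; rewrite !mxE.
have Tlin al : E (F (lincomb a' al)) = lincomb b (al *m A).
  by rewrite 2!lincomb_op -lincomb_mul; apply: eq_lincomb => i; rewrite /= Ta'.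
have Mlin be : M (lincomb b be) = 0.
  by rewrite lincomb_op /lincomb big1// => i _; rewrite /= Mb scaler0.
(* The range of F is the sum of the range of D and the span of the a'_i, on which E F acts as the
   matrix A. *)
have split x : F x = x -> exists d al, D d = d /\ x = d + lincomb a' al.
  move=> Fx; have [|al /subr0_eq alP] := aS ((F - D) x); first by exists x.
  exists (D x + lincomb h (\row_i al i)), (\row_i al i); split.
    rewrite raddfD/= oproj_fix// lincomb_op; congr (_ + _).
    by apply: eq_lincomb => i; rewrite /= (hP i).1.
  rewrite lincombBv -addrA [lincomb h _ + _]addrC subrK -lincomb_row -alP opB Fx.
  by rewrite addrC subrK.
have Dlin al : D (lincomb a' al) = - lincomb h al.
  rewrite lincombBv raddfB/= [D (lincomb a al)]lincomb_op [lincomb (D \o a) _](_ : _ = 0).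
    by rewrite sub0r lincomb_op; congr (- _); apply: eq_lincomb => i; rewrite /= (hP i).1.
  by rewrite /lincomb big1// => i _; rewrite /= Da scaler0.
have a'free al : lincomb a' al = 0 -> al = 0.
  move=> al0; apply: (lincomb_free aF); move: (Dlin al); rewrite al0 raddf0/=.
  by move=> /esym/eqP; rewrite oppr_eq0 => /eqP hal; rewrite lincombBv hal subr0 in al0.
(* Vectors are rows: the kernel corresponds to the left kernel of A, of dimension n - rank A, and
   the cokernel to a complement of its row space, of dimension c - rank A. *)
exists (\rank (kermx A)), (\rank (A^C)%MS); split; last first.
- have rn := rank_leq_row A; have rc := rank_leq_col A.
  rewrite mxrank_ker mxrank_compl -!subzn//.
  by rewrite opprB addrA subrK.
- pose C := row_base (A^C)%MS.
  exists (fun i => lincomb b (row i C)); split.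
  + move=> i; apply/(oprojP _ pE); rewrite lincomb_op.
    by apply: eq_lincomb => j; rewrite /= Eb.
  + move=> ga; rewrite lincomb_row lincomb_mul; set g := \row_i ga i.
    move=> [x /(oprojP _ pF) Fx TxE]; rewrite opM in TxE.
    have [d [al [Dd xE]]] := split x Fx.
    (* M annihilates the span of b and fixes the images of the range of D, which separates the two
       parts of the equation. *)
    have Td : E (F d) = 0.
      have := congr1 M TxE; rewrite Mlin xE 2!raddfD/= Tlin raddfD/= Mlin addr0.
      by rewrite sM.
    have gA : g *m C = al *m A.
      apply: subr0_eq; apply: (lincomb_free bF); rewrite lincombB -TxE -Tlin xE.
      by rewrite 2!raddfD/= Td add0r subrr.
    have g0 : g *m C = 0.
      apply/eqP; rewrite -submx0 -(capmx_compl A) sub_capmx; apply/andP; split.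
        by rewrite gA submxMl.
      by rewrite (submx_trans (submxMl _ _))// eq_row_base.
    have : g = 0 by apply: (row_free_inj (row_base_free (A^C)%MS)); rewrite mul0mx.
    by move=> g00 i; have /rowP/(_ i) := g00; rewrite !mxE.
  + move=> y /(oprojP _ pE) Ey.
    have [|be /subr0_eq beP] := bS ((E - M) y); first by exists y.
    have : (\row_i be i <= A + A^C)%MS by rewrite submx_full// addsmx_compl_full.
    move=> /sub_addsmxP[[al ga] /= beE].
    have [w wE] : exists w, ga *m (A^C)%MS = w *m C.
      by apply/submxP; rewrite eq_row_base submxMl.
    exists (fun i => w 0 i); have -> : \sum_i w 0 i *: lincomb b (row i C) = lincomb b (w *m C).
      by rewrite -lincomb_mul.
    have [d Dd Td] := onM _ (oproj_fix y pM).
    exists (d + lincomb a' al).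
      apply/(oprojP _ pF); rewrite raddfD/= (FDx _ Dd); congr (_ + _).
      by rewrite lincomb_op; apply: eq_lincomb => i; rewrite /= Fa'.
    rewrite 2!raddfD/= Td Tlin; apply/eqP; rewrite eq_sym subr_eq -addrA -lincombD -wE.
    by rewrite -beE -lincomb_row -beP opB Ey addrC subrK.
- pose K := row_base (kermx A).
  have KA : K *m A = 0 by apply/sub_kermxP; rewrite eq_row_base.
  exists (fun i => lincomb a' (row i K)); split.
  + move=> i; split.
      apply/(oprojP _ pF); rewrite lincomb_op.
      by apply: eq_lincomb => j; rewrite /= Fa'.
    by rewrite /= Tlin -row_mul KA row0 lincomb0.
  + move=> ga; rewrite lincomb_row lincomb_mul; set g := \row_i ga i.
    move=> /a'free gK; have : g = 0.
      by apply: (row_free_inj (row_base_free (kermx A))); rewrite mul0mx.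
    by move=> g00 i; have /rowP/(_ i) := g00; rewrite !mxE.
  + move=> x [/(oprojP _ pF) Fx /= Tx0].
    have [d [al [Dd xE]]] := split x Fx.
    have Td : E (F d) = 0.
      have := congr1 M Tx0; rewrite raddf0/= xE 2!raddfD/= Tlin raddfD/= Mlin addr0.
      by rewrite sM.
    have d0 := inj _ Dd Td.
    have : (al <= K)%MS.
      rewrite eq_row_base; apply/sub_kermxP; apply: (lincomb_free bF).
      by rewrite -Tlin -Tx0 xE d0 add0r.
    move=> /submxP[w wE]; exists (fun i => w 0 i).
    have -> : \sum_i w 0 i *: lincomb a' (row i K) = lincomb a' (w *m K).
      by rewrite -lincomb_mul.
    by rewrite /= -wE xE d0 add0r subrr.
Qed.

End index.

(** * Local constancy of the index *)

Section index_invariance.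
Context {R : realType} {H : hilbertType R}.
Implicit Types (E F D M P Q : bounded_op H) (x y z : H).

Lemma nrm_op_unit (T : bounded_op H) (m : R) :
  (forall x, nrm x <= 1 -> nrm (T x) <= m) -> nrm T <= m.
Proof.
move=> Tm; rewrite -lecR -nrmE; apply: op_norm_le => x x1.
by rewrite nrmE lecR Tm// -lecR -nrmE.
Qed.

Lemma subrACA (V : zmodType) (a b c d : V) : a - b - (c - d) = (a - c) - (b - d).
Proof. by rewrite opprD addrACA -opprD. Qed.

(** Let E = 1 - P. For T = (1 - Q) E the product T^* T = E - E Q E is compact, hence so are T and
    its adjoint, and E - Q = E (1 - Q) - P Q. Conversely, P Q = - P (E - Q) and E - E Q E = E (E -
    Q) E. *)
Lemma C1E P Q : C1 (P, Q) <->
  [/\ is_orthoproj_infty P, is_orthoproj Q & compact_op (1 - P - Q)].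
Proof.
split=> [[/= iP [pQ cPQ c2]]|[iP pQ cPQ]].
  have [pP _ _] := iP; split => //; set E := 1 - P in c2 *.
  have pE : is_orthoproj E by exact: oproj_compl.
  have cT : compact_op ((1 - Q) * E).
    apply: (@compact_op_TT _ _ (E * (1 - Q))).
      by apply: adjM; [exact/oproj_adj/oproj_compl|exact: oproj_adj].
    have -> : E * (1 - Q) * ((1 - Q) * E) = E - E * Q * E.
      rewrite mulrA -(mulrA E) (oproj_idem (oproj_compl pQ)) [E * (1 - Q)]mulrBr mulr1.
      by rewrite mulrBl oproj_idem.
    exact: c2.
  have cT' : compact_op (E * (1 - Q)).
    apply: compact_op_adj cT.
    by apply: adjM; [exact/oproj_adj/oproj_compl|exact: oproj_adj].
  have -> : E - Q = E * (1 - Q) - P * Q.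
    have EPQ : E * Q + P * Q = Q by rewrite -mulrDl /E subrK mul1r.
    by rewrite -[X in E - X = _]EPQ mulrBr mulr1 opprD addrA.
  exact: compact_opB.
have [pP _ _] := iP; split => //; split => //=.
  have -> : P * Q = - (P * (1 - P - Q)).
    by rewrite !mulrBr mulr1 oproj_idem// subrr sub0r opprK.
  exact/compact_opN/compact_op_mull.
have pE := oproj_compl pP.
have cornerE E : is_orthoproj E -> E - E * Q * E = E * (E - Q) * E.
  by move=> pE'; rewrite mulrBr mulrBl !oproj_idem.
rewrite cornerE//.
exact/compact_op_mulr/compact_op_mull.
Qed.

Lemma finite_oproj_compact P n : is_orthoproj P -> has_dim (range P) n -> compact_op P.
Proof. by move=> pP /(finite_oproj_shift pP)[e]; exact: shift_compact. Qed.

(** If F had finite rank, E = (E - F) + F would be a compact projection, hence of finite rank. *)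
Lemma compact_diff_infinite E F : is_orthoproj E -> is_orthoproj F ->
  compact_op (E - F) -> infinite_dimensional (range E) -> infinite_dimensional (range F).
Proof.
move=> pE pF cEF iE [n dF]; apply: iE; apply: compact_oproj_finite => //.
by rewrite -(subrK F E); apply: compact_opD => //; exact: finite_oproj_compact dF.
Qed.

(* The range of the compact operator F (1 - E) is nearly contained in a
   finite-dimensional subspace of the range of F; D projects on its complement. *)
Lemma small_corner E F (r : R) : is_orthoproj E -> is_orthoproj F ->
  compact_op (E - F) -> infinite_dimensional (range F) -> 0 < r ->
  exists n0, forall n, (n0 <= n)%N -> exists D a, [/\ is_orthoproj D, F * D = D,
    shift (F - D) (fun i => (i < n)%N) a a & nrm ((1 - E) * D) <= r].
Proof.
move=> pE pF cEF iF r0.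
have cK : compact_op (F * (1 - E)).
  have -> : F * (1 - E) = - (F * (E - F)).
    by rewrite !mulrBr mulr1 oproj_idem// opprB.
  exact/compact_opN/compact_op_mull.
have [l l1 lP] := compact_op_totally_bounded cK r0.
pose y j := (F * (1 - E)) l`_j.
have [j|e [oe eF eE]] := gram_schmidt (linear_subspace_range F) iF (y := y).
  by exists ((1 - E) l`_j).
(* The span of the first [size l] vectors e_i contains the images of the net, and so does that of
   any longer initial block. This is what leaves n free. *)
exists (size l) => n ln.
have [Q hQ] : exists Q, shift Q (fun i => (i < n)%N) e e.
  by apply: shift_exists => i j _ _; exact: oe.
have FQ : F * Q = Q.
  by apply: (shift_mull hQ pF) => i _; exact/(oprojP _ pF).
have pD := oproj_sub pF (shift_oproj hQ) FQ.
exists (F - Q), e; split => //.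
- by rewrite mulrBr oproj_idem// FQ.
- by rewrite opprB addrC subrK.
have DF : (F - Q) * F = F - Q.
  by rewrite mulrBl oproj_idem// (oproj_mulC pF (shift_oproj hQ) FQ).
(* The net belongs to F (1 - E), so the corner is estimated through its adjoint. *)
rewrite -(@adj_nrm _ _ _ ((F - Q) * (1 - E))); last first.
  by apply: adjM; [exact/oproj_adj/oproj_compl|exact: oproj_adj].
apply: nrm_op_unit => x x1; have [z zl xz] := lP x x1.
have Dz : (F - Q) ((F * (1 - E)) z) = 0.
  rewrite -(nth_index 0 zl) -/(y (index z l)).
  have jn : (index z l < n)%N by rewrite (leq_trans _ ln)// index_mem.
  rewrite eE /fsum lincomb_row lincomb_op /lincomb big1// => i _.
  have i_n : (i < n)%N by rewrite (leq_trans (ltn_ord i)).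
  rewrite /comp opB (shift_basis hQ)// (_ : F (e i) = e i) ?subrr ?scaler0//.
  exact/(oprojP _ pF).
have -> : ((F - Q) * (1 - E)) x = (F - Q) ((F * (1 - E)) x - (F * (1 - E)) z).
  by rewrite op_sub Dz subr0 -[RHS]opM mulrA DF.
by rewrite (le_trans (oproj_nrm _ pD))// ltW.
Qed.

(** On the range of D, E differs from the identity by at most r. *)
Lemma corner_bounded_below E D (r : R) : is_orthoproj D -> nrm ((1 - E) * D) <= r ->
  r < 1 -> bounded_below (E * D) D (1 - r).
Proof.
move=> pD Dr r1; split; first by rewrite -mulrA oproj_idem.
  by rewrite subr_gt0.
move=> x; have -> : (E * D) x = D x - ((1 - E) * D) (D x).
  by rewrite !opE oproj_fix// subKr.
rewrite mulrBl mul1r -[X in _ <= X]/(nrm _) (le_trans _ (nrm_sub_ge _ _))//.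
rewrite nrmN lerB// (le_trans (nrm_op _ _))//.
by rewrite ler_wpM2r ?nrm_ge0.
Qed.

(** E - M is the sum of E - F, F - D and D - M. The last is compact because D and E D differ by the
    compact operator (E - F) D up to sign. A compact projection has finite rank. *)
Lemma corner_range E F D M (r : R) n : is_orthoproj E -> is_orthoproj F ->
  is_orthoproj D -> F * D = D -> compact_op (E - F) -> has_dim (range (F - D)) n ->
  bounded_below (E * D) D r -> rproj M (E * D) ->
  [/\ E * M = M, compact_op (E - M) & exists c, has_dim (range (E - M)) c].
Proof.
move=> pE pF pD FD cEF dFD bED rM; have [pM _ _] := rM.
have EM : E * M = M by apply: rproj_mull rM _; rewrite mulrA oproj_idem.
have bD : bounded_below D D 1.
  by split; rewrite ?oproj_idem// => x; rewrite mul1r.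
have cEM : compact_op (E - M).
  have -> : E - M = (E - F) + (F - D) + (D - M) by rewrite !subrKA.
  apply: compact_opD; first apply: compact_opD => //.
    by apply: finite_oproj_compact dFD; exact: oproj_sub.
  apply: (rproj_compact pD pD bD bED (rproj_id pD) rM).
  have -> : D - E * D = - ((E - F) * D) by rewrite mulrBl FD opprB.
  exact/compact_opN/compact_op_mulr.
split => //; apply: compact_oproj_finite => //.
exact: oproj_sub.
Qed.

(** D' and M' project onto the images of the range of D under F' and E' F'. As |D - F' D| <= 1/16
    and |E D - E' F' D| <= 1/8, the lower bounds 1 and 7/8 stay above 1/2, and [rproj_near] with d =
    1/2 gives |D - D'| <= 1/4 and |M - M'| <= 1/2. Adding 1/16 keeps both below 1, so that the
    coranks n and c are preserved. *)
Lemma index_near E F D M n c E' F' :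
  is_orthoproj E -> is_orthoproj F -> is_orthoproj D -> F * D = D ->
  nrm ((1 - E) * D) <= 8^-1 -> rproj M (E * D) -> E * M = M ->
  has_dim (range (F - D)) n -> has_dim (range (E - M)) c ->
  is_orthoproj E' -> is_orthoproj F' ->
  nrm (E - E') <= 16^-1 -> nrm (F - F') <= 16^-1 ->
  has_fredholm_index (range F') (range E') (E' * F' : H -> H) (n%:Z - c%:Z).
Proof.
move=> pE pF pD FD ED8 rM EM dFD dEM pE' pF' EE' FF'; have [pM _ _] := rM.
have DFn : nrm (D - F' * D) <= 16^-1.
  rewrite -[X in nrm (X - _)]FD -mulrBl (le_trans (nrm_opM _ _))//.
  by rewrite -[leRHS]mulr1 ler_pM ?nrm_ge0// oproj_nrm1.
have EFn : nrm (E * D - E' * F' * D) <= 8^-1.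
  have -> : E * D - E' * F' * D = E * (D - F' * D) + (E - E') * (F' * D).
    by rewrite mulrBr mulrBl !mulrA addrA subrK.
  rewrite (le_trans (nrmD _ _))// (_ : 8^-1 = 16^-1 + 16^-1 :> R); last by lra.
  rewrite lerD// (le_trans (nrm_opM _ _))//.
    by rewrite -[leRHS]mul1r ler_pM ?nrm_ge0// oproj_nrm1.
  rewrite -[leRHS]mulr1 ler_pM ?nrm_ge0// (le_trans (nrm_opM _ _))//.
  by rewrite -[leRHS]mulr1 ler_pM ?nrm_ge0// oproj_nrm1.
have near_below T T' (r s : R) : bounded_below T D r -> nrm (T - T') <= s ->
    T' * D = T' -> 2^-1 <= r - s -> bounded_below T' D 2^-1.
  move=> [TD _ Tr] TTs TD' rs; split => // x.
  have -> : T' x = T x + (- ((T - T') (D x))).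
    by rewrite opB -opM -[T' (D x)]opM TD TD' subKr.
  rewrite (le_trans _ (nrm_sub_ge _ _))// nrmN.
  have h1 := Tr x; have h2 := nrm_op (T - T') (D x).
  have h3 := ler_wpM2r (nrm_ge0 (D x)) TTs.
  have h4 := ler_wpM2r (nrm_ge0 (D x)) rs.
  by rewrite mulrBl in h4; lra.
have bD : bounded_below D D 1 by split; rewrite ?oproj_idem// => x; rewrite mul1r.
have bD2 : bounded_below D D 2^-1.
  apply: (near_below D D 1 0) => //; first by rewrite subrr nrm0.
    by rewrite oproj_idem.
  by lra.
have bED := corner_bounded_below pD ED8 (_ : 8^-1 < 1).
have {}bED : bounded_below (E * D) D (1 - 8^-1) by apply: bED; lra.
have bED2 : bounded_below (E * D) D 2^-1.
  apply: (near_below _ (E * D) _ 0 bED); first by rewrite subrr nrm0.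
    by rewrite -mulrA oproj_idem.
  by lra.
have bFD : bounded_below (F' * D) D 2^-1.
  apply: (near_below _ _ _ _ bD DFn); first by rewrite -mulrA oproj_idem.
  by lra.
have bEFD : bounded_below (E' * F' * D) D 2^-1.
  apply: (near_below _ _ _ _ bED EFn); first by rewrite -(mulrA _ D) oproj_idem.
  by lra.
have [D' rD'] := rproj_exists pD (adjM (oproj_adj pF') (oproj_adj pD)) bFD.
have [M' rM'] := rproj_exists pD
  (adjM (adjM (oproj_adj pE') (oproj_adj pF')) (oproj_adj pD)) bEFD.
have [[pD' D'T [B D'E]] [pM' M'T [C M'E]]] := (rD', rM').
have FD' : F' * D' = D' by apply: rproj_mull rD' _; rewrite mulrA oproj_idem.
have EM' : E' * M' = M' by apply: rproj_mull rM' _; rewrite !mulrA oproj_idem.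
have DD' := rproj_near pD pD bD2 bFD (rproj_id pD) rD'.
have MM' := rproj_near pD pD bED2 bEFD rM rM'.
have dFD' : has_dim (range (F' - D')) n.
  apply: oproj_near_dim dFD; [exact: oproj_sub|exact: oproj_sub|].
  rewrite subrACA (le_lt_trans (nrmB _ _))//.
  by rewrite mulr2n in DD'; lra.
have dEM' : has_dim (range (E' - M')) c.
  apply: oproj_near_dim dEM; [exact: oproj_sub|exact: oproj_sub|].
  rewrite subrACA (le_lt_trans (nrmB _ _))//.
  by rewrite mulr2n in MM'; lra.
have D'P x : D' x = x -> x = F' (D (B x)) by move=> D'x; rewrite -{1}D'x D'E.
have bEFDx x : E' (F' (D x)) = 0 -> D x = 0.
  move=> x0; have [_ _ /(_ x)] := bEFD; rewrite !opM x0 nrm0 => h.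
  by apply: nrm_eq0; have := nrm_ge0 (D x); lra.
apply: (@has_fredholm_index_split _ _ E' F' D' M') => //.
- move=> x D'x; rewrite [in F' x](D'P _ D'x) oproj_fix// => /bEFDx Bx.
  by rewrite (D'P _ D'x) Bx raddf0.
- move=> x D'x; rewrite (D'P _ D'x) oproj_fix//.
  by rewrite -[E' _]/((E' * F' * D) (B x)) -opM M'T.
- move=> y M'y; exists (F' (D (C y))).
    by rewrite -[F' _]/((F' * D) (C y)) -opM D'T.
  by rewrite oproj_fix// -{2}M'y M'E.
Qed.

(** The level set of f through x is both open and closed relative to B. *)
Lemma locally_constant_connected (T : topologicalType) (U : Type) (B : set T)
    (f : T -> U) : connected B ->
  (forall x : T, B x -> \forall y \near x, B y -> f y = f x) ->
  forall x y : T, B x -> B y -> f y = f x.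
Proof.
move=> cB fB x y Bx By; pose A := B `&` [set z | f z = f x].
suff : A = B by move=> AB; have : B y by []; rewrite -AB => -[].
apply: cB; first by exists x.
  exists [set z | B z -> f z = f x]°; first exact: open_interior.
  apply/seteqP; split=> z [Bz].
    by move=> fz; split=> //; apply: filterS (fB z Bz) => w h /h ->.
  by move=> /interior_subset/(_ Bz).
exists (~` [set z | B z -> f z <> f x]°); first exact/open_closedC/open_interior.
apply/seteqP; split=> z [Bz].
  by move=> fz; split=> // /interior_subset/(_ Bz); apply.
move=> nz; split => //; apply: contrapT => fz; apply: nz.
by apply: filterS (fB z Bz) => w h /h ->.
Qed.

Lemma near_pair P Q (r : R) : 0 < r ->
  \forall z \near (P, Q), nrm (P - z.1) <= r /\ nrm (Q - z.2) <= r.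
Proof.
move=> r0; have r0' : 0 < r%:C :> R[i] by rewrite ltcR.
exists (ball P r%:C, ball Q r%:C); first by split; exact: nbhsx_ballx.
by move=> z [/= /ball_nrm/ltW h1 /ball_nrm/ltW h2].
Qed.

(** The radius is that of [index_near]. One k serves for the centre and for all its neighbours in
    C_1. *)
Lemma C1_index_near P Q : C1 (P, Q) -> exists k,
  forall z : bounded_op H * bounded_op H, C1 z ->
    nrm (P - z.1) <= 16^-1 /\ nrm (Q - z.2) <= 16^-1 ->
    has_fredholm_index (range z.2) (range (1 - z.1)) ((1 - z.1) * z.2 : H -> H) k.
Proof.
move=> /C1E[[pP _ iP] pQ cPQ].
have pE := oproj_compl pP.
have iE : infinite_dimensional (range (1 - P)) by rewrite range_compl.
have iF := compact_diff_infinite pE pQ cPQ iE.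
have r0 : 0 < 8^-1 :> R by lra.
have r1 : 8^-1 < 1 :> R by lra.
have [n /(_ n (leqnn n))] := small_corner pE pQ cPQ iF r0.
move=> [D [a [pD FD /shift_has_dim dFD ED8]]].
have bED := corner_bounded_below pD ED8 r1.
have [M rM] := rproj_exists pD (adjM (oproj_adj pE) (oproj_adj pD)) bED.
have [EM _ [c dEM]] := corner_range pE pQ pD FD cPQ dFD bED rM.
exists (n%:Z - c%:Z) => -[P' Q'] /C1E[[pP' _ _] pQ' _] [hP hQ].
apply: (index_near pE pQ pD FD ED8 rM EM dFD dEM) => //; first exact: oproj_compl.
by rewrite opprB addrC addrA subrK nrmC.
Qed.

Lemma restricted_indexE P Q k :
  has_fredholm_index (range Q) (range (1 - P)) ((1 - P) * Q : H -> H) k ->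
  restricted_index (1 - P) Q = k.
Proof.
by move=> hk; rewrite /restricted_index (fredholm_indexE _ hk)//; exact: linear_subspace_range.
Qed.

Lemma component_index (z z' : bounded_op H * bounded_op H) : connected_component C1 z z' ->
  restricted_index (1 - z.1) z.2 = restricted_index (1 - z'.1) z'.2 :> int.
Proof.
move=> [B [Bz BC1 cB] Bz'].
pose index (w : bounded_op H * bounded_op H) := restricted_index (1 - w.1) w.2.
apply: (locally_constant_connected (f := index) cB) => //.
rewrite /index => -[P Q] /BC1 PQ; have [k hk] := C1_index_near PQ.
have r0 : 0 < 16^-1 :> R by lra.
apply: filterS (near_pair P Q r0) => w hw /BC1 wC1.
rewrite (restricted_indexE (hk w wC1 hw)) (@restricted_indexE P Q k)//.
by apply: (hk (P, Q)) => //=; rewrite !subrr !nrm0; split; lra.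
Qed.

End index_invariance.

(** * Paths of projections *)

Section paths.
Context {R : realType} {H : hilbertType R}.
Implicit Types (E F D M P Q S T V p q pE pF qE qF : bounded_op H) (x y z : H).
Implicit Types (e f g : nat -> H) (I J : pred nat).

Lemma scale_opAl (a : R[i]) S T : (a *: S) * T = a *: (S * T).
Proof. exact: op_ext. Qed.

(** Infinite rank and corank of u propagate from t = 0 along the path, since projections at distance
    below 1 have ranges of the same dimension. *)
Lemma path_joined (u v : R -> bounded_op H) (K : R) :
  (forall t : R, 0 <= t <= 1 ->
     [/\ is_orthoproj (u t), is_orthoproj (v t) & compact_op (u t - v t)]) ->
  (forall s t : R, 0 <= s <= 1 -> 0 <= t <= 1 ->
     nrm (u s - u t) <= K * `|s - t| /\ nrm (v s - v t) <= K * `|s - t|) ->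
  C1 (1 - u 0, v 0) -> connected_component C1 (1 - u 0, v 0) (1 - u 1, v 1).
Proof.
move=> uvP uvK uv0.
(* The retraction of the line onto [0, 1] has Lipschitz constant 1 and extends the path to a
   continuous function on all of [R]. *)
pose clamp (t : R) : R := if t <= 0 then 0 else if 1 <= t then 1 else t.
have clamp01 (t : R) : 0 <= clamp t <= 1.
  by rewrite /clamp; case: (leP t 0) => ?; case: (leP 1 t) => ?; apply/andP; split; lra.
have clamp_id t : 0 <= t <= 1 -> clamp t = t.
  by move=> /andP[t0 t1]; rewrite /clamp; case: (leP t 0) => ?; case: (leP 1 t) => ?; lra.
have clamp_lip s t : `|clamp s - clamp t| <= `|s - t|.
  wlog st : s t / s <= t => [h|].
    by case/orP: (le_total s t) => /h //; rewrite distrC [leRHS]distrC.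
  rewrite distrC [leRHS]distrC (@ger0_norm _ (t - s)) ?subr_ge0//.
  by rewrite ger0_norm; rewrite /clamp; case: (leP t 0) => ?; case: (leP 1 t) => ?;
    case: (leP s 0) => ?; case: (leP 1 s) => ?; lra.
have K0 : 0 <= K.
  have := (uvK 0 1 _ _).1; rewrite sub0r normrN normr1 mulr1 !lexx !ler01.
  by move=> /(_ isT isT); exact: le_trans (nrm_ge0 _).
pose f (t : R) := (1 - u (clamp t), v (clamp t)).
have cont_u : continuous (fun t : R => 1 - u (clamp t)).
  apply: (@lipschitz_path _ _ _ K) => s t; rewrite subrACA subrr sub0r nrmN.
  by rewrite (le_trans (uvK _ _ (clamp01 s) (clamp01 t)).1)// ler_wpM2l.
have cont_v : continuous (fun t : R => v (clamp t)).
  apply: (@lipschitz_path _ _ _ K) => s t.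
  by rewrite (le_trans (uvK _ _ (clamp01 s) (clamp01 t)).2)// ler_wpM2l.
have cont_f : continuous f by move=> t; exact: cvg_pair (cont_u t) (cont_v t).
have cI : connected [set t : R | 0 <= t <= 1].
  rewrite (_ : mkset _ = `[0, 1]%classic); first exact: segment_connected.
  by apply/seteqP; split=> t; rewrite /= in_itv.
have K1 : 0 < (K + 1)^-1 by rewrite invr_gt0 ltr_wpDl.
have near_lt (w : R -> bounded_op H) : (forall s t : R, 0 <= s <= 1 -> 0 <= t <= 1 ->
    nrm (w s - w t) <= K * `|s - t|) -> forall t : R, 0 <= t <= 1 ->
    \forall s \near t, 0 <= s <= 1 -> nrm (w t - w s) < 1.
  move=> wK t t01; apply: filterS (nbhsx_ballx t _ K1) => s; rewrite -ball_normE/=.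
  move=> ts s01; rewrite (le_lt_trans (wK _ _ t01 s01))//.
  rewrite (@le_lt_trans _ _ ((K + 1) * `|t - s|))//; first by rewrite ler_wpM2r// lerDl.
  by rewrite mulrC -ltr_pdivlMr ?ltr_wpDl// div1r.
have inf_const (w : R -> bounded_op H) : (forall s t : R, 0 <= s <= 1 -> 0 <= t <= 1 ->
    nrm (w s - w t) <= K * `|s - t|) -> (forall t : R, 0 <= t <= 1 -> is_orthoproj (w t)) ->
    infinite_dimensional (range (w 0)) ->
    forall t : R, 0 <= t <= 1 -> infinite_dimensional (range (w t)).
  move=> wK pw w0 t t01.
  suff -> : infinite_dimensional (range (w t)) = infinite_dimensional (range (w 0)) by [].
  apply: (locally_constant_connected
    (f := fun t : R => infinite_dimensional (range (w t))) cI) => //=; last by rewrite lexx ler01.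
  move=> r r01; apply: filterS (near_lt w wK r r01) => s h s01.
  apply/propext; split; apply: oproj_near_infinite; try exact: pw; last exact: h.
  by rewrite nrmC; exact: h.
have fC1 (t : R) : C1 (f t).
  have [[_ i0' i1'] _ _] := (C1E _ _).1 uv0.
  have [pu pv cuv] := uvP _ (clamp01 t).
  have pu0 : is_orthoproj (u 0) by have [|] := uvP 0; rewrite ?lexx ?ler01.
  apply/C1E; split => //; last by rewrite subKr.
  split; first exact: oproj_compl.
    apply: (inf_const (fun t : R => 1 - u t)) => //.
    + by move=> s s' h h'; rewrite subrACA subrr sub0r nrmN; exact: (uvK _ _ h h').1.
    + by move=> s /uvP[pus _ _]; exact: oproj_compl.
  rewrite -range_compl; last exact: oproj_compl.
  rewrite subKr; apply: (inf_const u) => //.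
  + by move=> s s' h h'; exact: (uvK _ _ h h').1.
  + by move=> s /uvP[].
  by rewrite -range_compl in i1'; [rewrite subKr in i1'|exact: oproj_compl].
have f0 : f 0 = (1 - u 0, v 0) by rewrite /f clamp_id// lexx ler01.
have f1 : f 1 = (1 - u 1, v 1) by rewrite /f clamp_id// lexx ler01.
exists (f @` [set t : R | 0 <= t <= 1]); first split.
- by exists 0; rewrite //= lexx ler01.
- by move=> _ [t _ <-].
- by apply: connected_continuous_connected => //; exact: continuous_subspaceT.
- by exists 1; rewrite //= lexx ler01.
Qed.

Definition segment S T (t : R) : bounded_op H := (1 - t)%:C *: S + t%:C *: T.

Lemma segment0 S T : segment S T 0 = S.
Proof. by rewrite /segment subr0 scale1r scale0r addr0. Qed.

Lemma segment1 S T : segment S T 1 = T.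
Proof. by rewrite /segment subrr scale1r scale0r add0r. Qed.

Lemma segmentB S T (s t : R) : segment S T s - segment S T t = (s - t)%:C *: (T - S).
Proof.
rewrite /segment opprD addrACA -!scalerBl -!rmorphB scalerBr addrC.
by congr (_ + _); rewrite -scaleNr -rmorphN; congr (_%:C *: _); lra.
Qed.

Lemma rproj_segment S S' T T' D (d : R) : is_orthoproj D -> adj S S' -> adj T T' ->
  (forall t, 0 <= t <= 1 -> bounded_below (segment S T t) D d) ->
  exists (u : R -> bounded_op H) (K : R),
    (forall t, 0 <= t <= 1 -> rproj (u t) (segment S T t)) /\
    (forall s t, 0 <= s <= 1 -> 0 <= t <= 1 -> nrm (u s - u t) <= K * `|s - t|).
Proof.
move=> pD aS aT b.
have /choice[u uP] t : exists p, 0 <= t <= 1 -> rproj p (segment S T t).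
  have [t01|nt] := boolP (0 <= t <= 1); last by exists 0.
  have [p rp] := rproj_exists pD (adjD (adjZ (1 - t) aS) (adjZ t aT)) (b t t01).
  by exists p.
exists u, ((nrm (T - S) / d) *+ 2); split => // s t s01 t01.
rewrite (le_trans (rproj_near pD pD (b s s01) (b t t01) (uP s s01) (uP t t01)))//.
rewrite segmentB nrmZ nrm_real.
by rewrite [leRHS](_ : _ = `|s - t| * nrm (T - S) / d *+ 2)//; ring.
Qed.

(** Along the two segments the difference stays a combination of S - U and T - V, hence compact, and
    [rproj_compact] transfers this to the projections. *)
Lemma rproj_joined S S' T T' D d U U' V V' D' d' p0 p1 q0 q1 :
  is_orthoproj D -> adj S S' -> adj T T' ->
  (forall t, 0 <= t <= 1 -> bounded_below (segment S T t) D d) ->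
  is_orthoproj D' -> adj U U' -> adj V V' ->
  (forall t, 0 <= t <= 1 -> bounded_below (segment U V t) D' d') ->
  compact_op (S - U) -> compact_op (T - V) ->
  rproj p0 S -> rproj p1 T -> rproj q0 U -> rproj q1 V ->
  C1 (1 - p0, q0) -> connected_component C1 (1 - p0, q0) (1 - p1, q1).
Proof.
move=> pD aS aT bST pD' aU aV bUV cSU cTV rp0 rp1 rq0 rq1 C0.
have [u [K [uP uK]]] := rproj_segment pD aS aT bST.
have [v [L [vP vL]]] := rproj_segment pD' aU aV bUV.
have z01 : 0 <= (0 : R) <= 1 by rewrite lexx ler01.
have o01 : 0 <= (1 : R) <= 1 by rewrite lexx ler01.
have u0 : p0 = u 0 by apply: rproj_uniq rp0 _; rewrite -[S](segment0 S T); exact: uP.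
have u1 : p1 = u 1 by apply: rproj_uniq rp1 _; rewrite -[T](segment1 S T); exact: uP.
have v0 : q0 = v 0 by apply: rproj_uniq rq0 _; rewrite -[U](segment0 U V); exact: vP.
have v1 : q1 = v 1 by apply: rproj_uniq rq1 _; rewrite -[V](segment1 U V); exact: vP.
rewrite u0 v0 u1 v1 in C0 *.
apply: (path_joined (K := Num.max K L)) C0.
  move=> t t01; have [pu _ _] := uP t t01; have [pv _ _] := vP t t01; split => //.
  apply: rproj_compact (bST t t01) (bUV t t01) (uP t t01) (vP t t01) _ => //.
  rewrite /segment opprD addrACA -!scalerBr.
  by apply: compact_opD; exact: compact_opZ.
move=> s t s01 t01; split.
  by rewrite (le_trans (uK s t s01 t01))// ler_wpM2r// le_max lexx.
by rewrite (le_trans (vL s t s01 t01))// ler_wpM2r// le_max lexx orbT.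
Qed.

Lemma sqr_half_le (t a b X : R) : 0 <= b -> 0 <= X -> 0 <= t <= 1 ->
  ((1 - t) ^+ 2 + t ^+ 2) * X ^+ 2 <= b ^+ 2 -> 2^-1 * X <= b.
Proof.
move=> b0 X0 t01 h; rewrite -ler_sqr ?nnegrE ?mulr_ge0//.
by have := sqr_ge0 (1 - 2 * t); have := sqr_ge0 X; nra.
Qed.

(** p x and V x are orthogonal and of equal norm, so the point at time t has squared norm ((1 - t)^2
    + t^2) |p x|^2. *)
Lemma rotate_below I e f p V : shift p I e e -> shift V I e f ->
  (forall i j, inner (e i) (f j) = 0 :> R[i]) ->
  forall t, 0 <= t <= 1 -> bounded_below (segment p V t) p 2^-1.
Proof.
move=> hp hV ef t t01; have pp := shift_oproj hp; split.
- by rewrite /segment mulrDl !scale_opAl oproj_idem// (shift_comp _ hp hV hV).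
- by rewrite invr_gt0.
move=> x; apply: (sqr_half_le 0 (nrm_ge0 _) (nrm_ge0 _) t01).
have pV : inner (p x) (V x) = 0 :> R[i].
  apply: (shift_perp _ hp) => i Ii; rewrite innerC (shift_perp _ hV) ?conjC0// => j Jj.
  by rewrite innerC ef conjC0.
move: t01 => /andP[t0 t1].
rewrite /segment !opE nrm_sqrD_orth; last by rewrite innerZl innerZr pV !mulr0.
by rewrite !nrmZ !nrm_pos ?subr_ge0// !exprMn (shift_nrm _ hV hp) mulrDl.
Qed.

(** Both projections are carried along by restrictions of one shift V, so that the difference at the
    end of the segments is V (pE - pF), again compact. *)
Lemma rotate_joined I J e f pE pF qE qF : onf predT e -> onf predT f ->
  (forall i j, inner (e i) (f j) = 0 :> R[i]) ->
  shift pE I e e -> shift pF J e e -> shift qE I f f -> shift qF J f f ->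
  C1 (1 - pE, pF) -> connected_component C1 (1 - pE, pF) (1 - qE, qF).
Proof.
move=> oe of_ ef hpE hpF hqE hqF C0.
have [V hV] := shift_exists oe of_.
have onI K g : onf predT g -> onf K g by move=> og i j _ _; exact: og.
have [VE hVE] := shift_exists (onI I _ oe) (onI I _ of_).
have [VE' hVE'] := shift_exists (onI I _ of_) (onI I _ oe).
have [VF hVF] := shift_exists (onI J _ oe) (onI J _ of_).
have [VF' hVF'] := shift_exists (onI J _ of_) (onI J _ oe).
have [[_ _ _] _ cEF] := (C1E _ _).1 C0.
have pE' := shift_oproj hpE; have pF' := shift_oproj hpF.
have rE : rproj qE VE.
  split; [exact: shift_oproj hqE|exact: (shift_comp _ hVE hqE hVE)|].
  by exists VE'; rewrite (shift_comp _ hVE' hVE hqE).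
have rF : rproj qF VF.
  split; [exact: shift_oproj hqF|exact: (shift_comp _ hVF hqF hVF)|].
  by exists VF'; rewrite (shift_comp _ hVF' hVF hqF).
apply: (rproj_joined pE' (oproj_adj pE') (shift_adj hVE hVE') (rotate_below hpE hVE ef)
  pF' (oproj_adj pF') (shift_adj hVF hVF') (rotate_below hpF hVF ef)) => //.
- by rewrite subKr in cEF.
- rewrite -(shift_comp _ hpE hV hVE)// -(shift_comp _ hpF hV hVF)// -mulrBr.
  by apply: compact_op_mull; rewrite subKr in cEF.
- exact: rproj_id.
- exact: rproj_id.
Qed.

(* Splits the orthonormal sequence s into blocks of length c, n and infinity;
   the range of 1 - P is spanned by the first and third block and that of Q by
   the last two, so that Q has index n - c. *)
Definition normal_pair n c (PQ : bounded_op H * bounded_op H) := exists s p pE,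
  [/\ shift p predT s s, infinite_dimensional (Defs.kernel p),
      shift pE (fun i => (i < c)%N || (c + n <= i)%N) s s,
      shift PQ.2 (fun i => (c <= i)%N) s s & PQ.1 = 1 - pE].

(** The relative position of s and s' is arbitrary. The infinite-dimensional kernels of p and p'
    contain mutually orthogonal sequences e and f, which makes neighbours in the chain s, e, f, s'
    orthogonal. *)
Lemma normal_pair_joined n c PQ PQ' : normal_pair n c PQ -> normal_pair n c PQ' ->
  C1 PQ -> connected_component C1 PQ PQ'.
Proof.
case: PQ PQ' => [P Q] [P' Q'] [s [p [pE [hp ip hE /= hF ->]]]].
move=> [s' [p' [pE' [hp' ip' hE' /= hF' ->]]]] C0.
have [e [f [oe of_ pe p'f ef]]] := interleaved_onf
  (linear_subspace_kernel p) ip (linear_subspace_kernel p') ip'.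
have perp t q g : shift q predT t t -> (forall i, Defs.kernel q (g i)) ->
    forall i j, inner (t i) (g j) = 0 :> R[i].
  move=> hq qg i j; rewrite -(shift_basis hq (isT : predT i)).
  by rewrite (oproj_adj (shift_oproj hq)) qg inner0r.
have onI K g : onf predT g -> onf K g by move=> og i j _ _; exact: og.
have ex K g : onf predT g -> exists q, shift q K g g.
  by move=> og; apply: shift_exists; exact: onI.
have [[os _ _] [os' _ _]] := (hp, hp').
have [eE heE] := ex (fun i => (i < c)%N || (c + n <= i)%N) e oe.
have [eF heF] := ex (fun i => (c <= i)%N) e oe.
have [fE hfE] := ex (fun i => (i < c)%N || (c + n <= i)%N) f of_.
have [fF hfF] := ex (fun i => (c <= i)%N) f of_.
have C01 := rotate_joined os oe (perp _ _ _ hp pe) hE hF heE heF C0.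
have C12 := rotate_joined oe of_ ef heE heF hfE hfF (connected_component_sub C01).
have fs i j : inner (f i) (s' j) = 0 :> R[i] by rewrite innerC (perp _ _ _ hp' p'f) conjC0.
have C23 := rotate_joined of_ os' fs hfE hfF hE' hF' (connected_component_sub C12).
exact: connected_component_trans (connected_component_trans C01 C12) C23.
Qed.

(** With W the kernel of E, this supplies the target of the finite-rank part of Q: it is orthogonal
    to E, and also to its source a, so that the move is a rotation. *)
Lemma perp_sequence W n (a : nat -> H) : linear_subspace W -> infinite_dimensional W ->
  exists g, [/\ onf predT g, forall i, W (g i) &
    forall i j, (j < n)%N -> inner (g i) (a j) = 0 :> R[i]].
Proof.
move=> sW iW.
have [] := @sequence_rec _ H (fun k e u => [/\ W u, nrm u = 1,
    forall i, (i < k)%N -> inner u (e i) = 0 :> R[i] &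
    forall j, (j < n)%N -> inner u (a j) = 0 :> R[i]]).
- move=> k e e' u ee' [Wu u1 ue ua]; split => // i ik.
  by rewrite -ee'// ue.
- move=> k e _; have [u [Wu u1 ul]] := infinite_perp (mkseq e k ++ mkseq a n) sW iW.
  exists u; split => // i i_n; apply: ul; rewrite mem_cat; apply/orP; [left|right].
    by apply/mapP; exists i; rewrite ?mem_iota.
  by apply/mapP; exists i; rewrite ?mem_iota.
move=> g gP; exists g; split.
- by apply: onfP => [i|k i ik]; [have [] := gP i|have [_ _ ->] := gP k].
- by move=> i; have [] := gP i.
- by move=> i j jn; have [_ _ _ ->] := gP i.
Qed.

(** Write F x = d + al with d = D x, al = A x, and be = V x. The segment sends x to d + w - t (1 -
    E) d, where w = (1 - t) al + t be. As E be = 0, |<d, be>| <= |d| |al| / 8, whence |d + w| >= |F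
    x| / 2. The last term costs at most |F x| / 8, which leaves 3/8 >= 1/4. *)
Lemma straighten_below E F D A V (n : nat) a g : is_orthoproj E -> is_orthoproj F ->
  is_orthoproj D -> F * D = D -> nrm ((1 - E) * D) <= 8^-1 ->
  A = F - D -> shift A (fun i => (i < n)%N) a a -> shift V (fun i => (i < n)%N) a g ->
  (forall i, E (g i) = 0) -> (forall i j, (j < n)%N -> inner (g i) (a j) = 0 :> R[i]) ->
  forall t, 0 <= t <= 1 -> bounded_below (segment F (E * D + V) t) F 4^-1.
Proof.
move=> pE pF pD FD ED8 AE hA hV Eg ga t t01.
have DF := oproj_mulC pF pD FD.
have VA : V * A = V by exact: (shift_comp _ hA hV hV).
have pA := shift_oproj hA.
have VF : V * F = V.
  rewrite -{1}VA -mulrA (_ : A * F = A)//.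
  by rewrite AE mulrBl oproj_idem// DF.
split.
- by rewrite /segment mulrDl !scale_opAl oproj_idem// mulrDl VF -mulrA DF.
- by rewrite invr_gt0.
move=> x; set d := D x; set al := A x; set be := V x.
have FxE : F x = d + al by rewrite /al AE opB addrC subrK.
have dal : inner d al = 0 :> R[i].
  by rewrite /d /al (oproj_adj pD) AE -opM mulrBr DF oproj_idem// subrr inner0r.
have nbe : nrm be = nrm al by exact: shift_nrm hV hA.
have albe : inner al be = 0 :> R[i].
  apply: (shift_perp _ hA) => i i_n; rewrite innerC (shift_perp _ hV) ?conjC0// => j _.
  exact: ga.
have Ebe : E be = 0.
  apply: inner_eq0; rewrite (oproj_adj pE); apply: (shift_perp _ hV) => i _.
  by rewrite -(oproj_adj pE) Eg inner0l.
have Ed : nrm ((1 - E) d) <= 8^-1 * nrm d.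
  have -> : (1 - E) d = ((1 - E) * D) d by rewrite opM /d oproj_fix.
  by rewrite (le_trans (nrm_op _ _))// ler_wpM2r ?nrm_ge0.
have dbe : nrm (inner d be : R[i]) <= 8^-1 * nrm d * nrm al.
  have -> : inner d be = inner ((1 - E) d) be :> R[i].
    by rewrite (oproj_adj (oproj_compl pE)) opB Ebe subr0.
  by rewrite (le_trans (inner_le _ _))// nbe ler_wpM2r ?nrm_ge0.
move: (t01) => /andP[t0 t1].
pose w := (1 - t)%:C *: al + t%:C *: be.
have wn : nrm w ^+ 2 = ((1 - t) ^+ 2 + t ^+ 2) * nrm al ^+ 2.
  rewrite nrm_sqrD_orth; last by rewrite innerZl innerZr albe !mulr0.
  by rewrite !nrmZ !nrm_pos ?subr_ge0// !exprMn nbe mulrDl.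
have dw : inner d w = t%:C * inner d be :> R[i].
  by rewrite innerDr !innerZr dal mulr0 add0r conj_real.
have TE : segment F (E * D + V) t x = (d + w) + - (t%:C *: (1 - E) d).
  rewrite /segment !opE FxE -/d -/be /w !scalerDr !scalerN opprD opprK.
  have -> : (1 - t)%:C *: d = d - t%:C *: d by rewrite rmorphB scalerBl scale1r.
  rewrite -!addrA; congr (_ + _).
  by rewrite [RHS]addrA [RHS]addrC -[RHS]addrA; congr (_ + _); rewrite [RHS]addrCA.
have dwn : 2^-1 * nrm (F x) <= nrm (d + w).
  have X2 : nrm (F x) ^+ 2 = nrm d ^+ 2 + nrm al ^+ 2 by rewrite FxE nrm_sqrD_orth.
  have Y2 : nrm (d + w) ^+ 2 >= nrm d ^+ 2 + 2^-1 * nrm al ^+ 2 - 4^-1 * (nrm d * nrm al).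
    rewrite nrm_sqrD wn dw.
    have h1 := Re_le_nrm (- (t%:C * inner d be) : R[i]).
    rewrite nrmN nrmM nrm_pos// raddfN/= in h1.
    have h2 : t * nrm (inner d be : R[i]) <= 8^-1 * nrm d * nrm al.
      by rewrite (le_trans _ dbe)// ler_piMl ?nrm_ge0.
    have h3 : 2^-1 * nrm al ^+ 2 <= ((1 - t) ^+ 2 + t ^+ 2) * nrm al ^+ 2.
      by rewrite ler_wpM2r ?sqr_ge0//; have := sqr_ge0 (1 - 2 * t); nra.
    by lra.
  rewrite -ler_sqr ?nnegrE ?nrm_ge0 ?mulr_ge0 ?nrm_ge0// exprMn X2.
  by have := sqr_ge0 (nrm d - nrm al); have := nrm_ge0 d; have := nrm_ge0 al; nra.
rewrite TE (le_trans _ (nrm_sub_ge _ _))// nrmN nrmZ nrm_pos//.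
have dF : nrm d <= nrm (F x) by rewrite /d -DF opM oproj_nrm.
have : t * nrm ((1 - E) d) <= 8^-1 * nrm (F x).
  have h8 : 0 <= 8^-1 :> R by lra.
  rewrite (le_trans _ (ler_wpM2l h8 dF))//.
  by rewrite (le_trans _ Ed)// ler_piMl ?nrm_ge0.
by have := nrm_ge0 (F x); lra.
Qed.

End paths.

(** * Reduction to normal pairs *)

Section normal_form.
Context {R : realType} {H : hilbertType R}.
Implicit Types (E F D M P Q S T V p q : bounded_op H) (x y z : H).
Implicit Types (a b e g m s : nat -> H).

Definition cat_seq k a b i := if (i < k)%N then a i else b (i - k)%N.

Lemma cat_seq_lt k a b i : (i < k)%N -> cat_seq k a b i = a i.
Proof. by move=> ik; rewrite /cat_seq ik. Qed.

Lemma cat_seq_ge k a b i : cat_seq k a b (k + i) = b i.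
Proof. by rewrite /cat_seq ltnNge leq_addr/= addKn. Qed.

Lemma cat_seqP k a b i : (i < k)%N /\ cat_seq k a b i = a i \/
  exists2 j, i = (k + j)%N & cat_seq k a b i = b j.
Proof.
have [ik|ki] := ltnP i k; first by left; rewrite cat_seq_lt.
by right; exists (i - k)%N; rewrite -?[in cat_seq _ _ _ i](subnKC ki) ?cat_seq_ge ?subnKC.
Qed.

Lemma onf_cat k a b : onf (fun i => (i < k)%N) a -> onf predT b ->
  (forall i j, (i < k)%N -> inner (a i) (b j) = 0 :> R[i]) -> onf predT (cat_seq k a b).
Proof.
move=> oa ob ab i j _ _.
have [[ik ->]|[i' -> ->]] := cat_seqP k a b i; have [[jk ->]|[j' -> ->]] := cat_seqP k a b j.
- exact: oa.
- by rewrite ab// ltn_eqF// (leq_trans ik)// leq_addr.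
- by rewrite innerC ab// conjC0 gtn_eqF// (leq_trans jk)// leq_addr.
- by rewrite ob// eqn_add2l.
Qed.

(** The operator [E * D + V] does the move: it maps the range of D onto that of M, and each a_i to
    g_i in the kernel of E. The sequence s of the normal pair concatenates b, the first n of the g_i
    and an orthonormal basis m of the range of M. *)
Lemma straighten P Q n a D M c b : separable_space H ->
  C1 (P, Q) -> is_orthoproj D -> Q * D = D ->
  shift (Q - D) (fun i => (i < n)%N) a a -> nrm ((1 - (1 - P)) * D) <= 8^-1 ->
  rproj M ((1 - P) * D) -> (1 - P) * M = M -> compact_op (1 - P - M) ->
  shift (1 - P - M) (fun i => (i < c)%N) b b ->
  exists2 PQ', normal_pair n c PQ' & connected_component C1 (P, Q) PQ'.
Proof.
move=> sepH C0 pD FD hA ED8 rM EM cEM hB.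
have [[pP iP iE] pF cEF] := (C1E _ _).1 C0.
have pE := oproj_compl pP; have [pM _ [B0 ME0]] := rM.
rewrite -range_compl// in iE.
have PE : P = 1 - (1 - P) by rewrite subKr.
set E := 1 - P in ED8 rM EM cEM hB cEF pE iE ME0 PE.
have iK : infinite_dimensional (Defs.kernel E) by rewrite -range_compl// -PE.
have [g [og Eg ga]] := perp_sequence n a (linear_subspace_kernel E) iK.
have {}Eg i : E (g i) = 0 := Eg i.
have [oa _ _] := hA.
have ogn : onf (fun i => (i < n)%N) g by move=> i j _ _; exact: og.
have [V hV] := shift_exists oa ogn; have [V' hV'] := shift_exists ogn oa.
have [G hG] := shift_exists ogn ogn.
have pG := shift_oproj hG; have pA := shift_oproj hA.
have DF := oproj_mulC pF pD FD; have MEE := oproj_mulC pE pM EM.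
have EV : E * V = 0.
  apply: op_ext => x; rewrite opM op0; apply: inner_eq0.
  rewrite (oproj_adj pE); apply: (shift_perp _ hV) => i _.
  by rewrite -(oproj_adj pE) Eg inner0l.
have GE : G * E = 0.
  apply: op_ext => x; rewrite opM op0; apply: (shift_eq0 hG) => i _.
  by rewrite (oproj_adj pE) Eg inner0r.
have Da i : (i < n)%N -> D (a i) = 0.
  move=> i_n; rewrite -(shift_basis hA i_n) -opM mulrBr DF oproj_idem// subrr.
  by [].
have VD : V * D = 0.
  apply: op_ext => x; rewrite opM op0; apply: (shift_eq0 hV) => i i_n.
  by rewrite (oproj_adj pD) Da// inner0r.
have DV' : D * V' = 0.
  apply: op_ext => x; rewrite opM op0; apply: inner_eq0.
  rewrite (oproj_adj pD); apply: (shift_perp _ hV') => i i_n.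
  by rewrite -(oproj_adj pD) Da// inner0l.
have GM : G * M = 0 by rewrite -EM mulrA GE mul0r.
have pGM : is_orthoproj (G + M) by exact: oproj_add.
have MD : M * (E * D) = E * D by case: rM.
have rF : rproj (G + M) (E * D + V).
  split => //.
    rewrite mulrDl !mulrDr MD [G * (E * D)]mulrA GE mul0r add0r.
    rewrite (shift_comp _ hV hG hV)// -MEE -[M * E * V]mulrA EV mulr0 addr0.
    by rewrite addrC.
  exists (D * B0 + V').
  rewrite mulrDl !mulrDr -[E * D * V']mulrA DV' mulr0 addr0.
  rewrite [V * (D * B0)]mulrA VD mul0r add0r (shift_comp _ hV' hV hG)//.
  by rewrite mulrA -[E * D * D]mulrA oproj_idem// -ME0 addrC.
have aF : adj (E * D + V) (D * E + V').
  exact: adjD (adjM (oproj_adj pE) (oproj_adj pD)) (shift_adj hV hV').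
have bEE t : 0 <= t <= 1 -> bounded_below (segment E E t) E 1.
  move=> _; rewrite /segment -scalerDl -rmorphD subrK scale1r.
  by split; rewrite ?oproj_idem// => x; rewrite mul1r.
have C1' : connected_component C1 (P, Q) (P, G + M).
  rewrite PE; apply: (rproj_joined pE (oproj_adj pE) (oproj_adj pE) bEE
    pF (oproj_adj pF) aF (straighten_below pE pF pD FD ED8 erefl hA hV Eg ga)) => //.
  (* D differs from Q by a finite-rank operator, Q from E by a compact one, and V has finite
     rank. *)
  - rewrite (_ : E - _ = - (E * (D - Q) + E * (Q - E) + V)).
      apply/compact_opN/compact_opD; last exact: shift_compact hV.
      apply: compact_opD; apply: compact_op_mull; rewrite -opprB; apply: compact_opN => //.
      exact: shift_compact hA.
    by rewrite -mulrDr addrA subrK mulrBr oproj_idem// [RHS]opprD opprB opprD addrA.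
  - exact: rproj_id.
  - exact: rproj_id.
  - exact: rproj_id.
  - by rewrite -PE.
have iM : infinite_dimensional (range M) by exact: compact_diff_infinite cEM iE.
(* Separability enters here, to index a basis of the range of M by the natural numbers. *)
have [m hm] := separable_onb sepH pM iM.
have [om _ _] := hm; have [ob _ _] := hB.
have Bb i : (i < c)%N -> E (b i) = b i /\ M (b i) = 0.
  move=> ic; rewrite -(shift_basis hB ic); split.
    by rewrite -opM mulrBr oproj_idem// EM.
  by rewrite -opM mulrBr MEE oproj_idem// subrr.
have Mm i : M (m i) = m i by exact: (shift_basis hm).
have Em i : E (m i) = m i by rewrite -Mm -opM EM.
have gm i j : inner (g i) (m j) = 0 :> R[i].
  by rewrite -Em -(oproj_adj pE) Eg inner0l.
have bg i j : (i < c)%N -> inner (b i) (g j) = 0 :> R[i].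
  by move=> /Bb[<- _]; rewrite (oproj_adj pE) Eg inner0r.
have bm i j : (i < c)%N -> inner (b i) (m j) = 0 :> R[i].
  by move=> /Bb[_ bM]; rewrite -Mm -(oproj_adj pM) bM inner0l.
pose gm_seq := cat_seq n g m; pose s := cat_seq c b gm_seq.
have gmP i : (i < n)%N /\ gm_seq i = g i \/ exists2 j, i = (n + j)%N & gm_seq i = m j.
  exact: cat_seqP.
have sP i : (i < c)%N /\ s i = b i \/ exists2 j, i = (c + j)%N & s i = gm_seq j.
  exact: cat_seqP.
have ogm : onf predT gm_seq by apply: onf_cat => // i j _; exact: gm.
have os : onf predT s.
  apply: onf_cat => // i j ic.
  by have [[jn ->]|[j' _ ->]] := gmP j; [exact: bg|exact: bm].
have [p hp] := shift_exists os os.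
have hE : shift E (fun i => (i < c)%N || (c + n <= i)%N) s s.
  have [p' hp'] : exists p', shift p' (fun i => (i < c)%N || (c + n <= i)%N) s s.
    by apply: shift_exists => i j _ _; exact: os.
  rewrite (shift_oprojE hp' pE) => // [i|x Ex xs].
    have [[ic si]|[i' iE' si]] := sP i.
      by rewrite si (Bb _ ic).1.
    have [[i'n gi]|[j jE gi]] := gmP i'; last first.
      by rewrite si gi Em.
    by rewrite iE' ltnNge leq_addr/= leq_add2l leqNgt i'n.
  have Bx : (E - M) x = 0.
    apply: (shift_eq0 hB) => i ic; rewrite -(xs i) ?ic//.
    by rewrite /s cat_seq_lt.
  have Mx : M x = 0.
    apply: (shift_eq0 hm) => i _; rewrite -(xs (c + (n + i))%N).
      by rewrite /s cat_seq_ge /gm_seq cat_seq_ge.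
    by rewrite leq_add2l leq_addr orbT.
  by rewrite -Ex -[E](subrK M) opD Bx Mx addr0.
have hF : shift (G + M) (fun i => (c <= i)%N) s s.
  have [p' hp'] : exists p', shift p' (fun i => (c <= i)%N) s s.
    by apply: shift_exists => i j _ _; exact: os.
  rewrite (shift_oprojE hp' pGM) => // [i ci|x GMx xs].
    rewrite -(subnKC ci) /s cat_seq_ge.
    have [[jn ->]|[j' _ ->]] := gmP (i - c)%N.
      by rewrite opD (shift_basis hG)// -MEE opM Eg raddf0 addr0.
    by rewrite opD Mm -Em -opM GE op0 Em add0r.
  have Gx : G x = 0.
    apply: (shift_eq0 hG) => i i_n; rewrite -(xs (c + i)%N) ?leq_addr//.
    by rewrite /s cat_seq_ge /gm_seq cat_seq_lt.
  have Mx : M x = 0.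
    apply: (shift_eq0 hm) => i _; rewrite -(xs (c + (n + i))%N) ?leq_addr//.
    by rewrite /s cat_seq_ge /gm_seq cat_seq_ge.
  by rewrite -GMx opD Gx Mx addr0.
(* The g_(n + i) are left out of s and orthogonal to all of it, so the kernel of p contains k + 1
   independent vectors for every k. *)
exists (P, G + M) => //; exists s, p, E; split => // -[k dk].
have ok : onf (fun i => (i < k.+1)%N) (fun i => g (n + i)%N).
  by move=> i j _ _; rewrite og// eqn_add2l.
have := has_dim_free dk (onf_free ok); rewrite ltnn => /(_ _)/notF; apply => i.
rewrite /Defs.kernel/=; apply: (shift_eq0 hp) => j _.
have [[jc ->]|[j' _ ->]] := sP j.
  by rewrite innerC bg// conjC0.
have [[jn ->]|[j'' _ ->]] := gmP j'; last exact: gm.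
by rewrite og// gtn_eqF// (leq_trans jn)// leq_addr.
Qed.

(** The bound comes from [small_corner]; c varies with n, their difference being the index. *)
Lemma normal_form P Q : separable_space H -> C1 (P, Q) -> exists n0, forall n, (n0 <= n)%N ->
  exists c PQ', [/\ restricted_index (1 - P) Q = n%:Z - c%:Z,
    normal_pair n c PQ' & connected_component C1 (P, Q) PQ'].
Proof.
move=> sepH C0; have [[pP iP iE] pF cEF] := (C1E _ _).1 C0.
have pE := oproj_compl pP; rewrite -range_compl// in iE.
have iF := compact_diff_infinite pE pF cEF iE.
have r0 : 0 < 8^-1 :> R by lra.
have r1 : 8^-1 < 1 :> R by lra.
have [n0 n0P] := small_corner pE pF cEF iF r0.
exists n0 => n /n0P[D [a [pD FD hA ED8]]].
have bED := corner_bounded_below pD ED8 r1.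
have [M rM] := rproj_exists pD (adjM (oproj_adj pE) (oproj_adj pD)) bED.
have dA := shift_has_dim hA.
have [EM cEM [c dEM]] := corner_range pE pF pD FD cEF dA bED rM.
have [pM _ _] := rM.
have [b hB] := finite_oproj_shift (oproj_sub pE pM EM) dEM.
have [PQ' nPQ' CPQ'] := straighten sepH C0 pD FD hA ED8 rM EM cEM hB.
exists c, PQ'; split => //; apply: restricted_indexE.
apply: (index_near pE pF pD FD ED8 rM EM dA dEM) => //.
all: by rewrite subrr nrm0; lra.
Qed.

End normal_form.

Theorem theorem6p5 (R : realType) (H : hilbertType R)
    (sepH : separable_space H) (dimH : infinite_dimensional [set: H])
    (P Q P' Q' : bounded_op H) (PQ : C1 (P, Q)) (PQ' : C1 (P', Q')) :
  connected_component C1 (P, Q) (P', Q') <->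
  restricted_index (1 - P) Q = restricted_index (1 - P') Q'.
Proof.
split=> [/component_index//|kk'].
have [n0 n0P] := normal_form sepH PQ; have [n1 n1P] := normal_form sepH PQ'.
have [c [z [kE nz Cz]]] := n0P (maxn n0 n1) (leq_maxl _ _).
have [c' [z' [kE' nz' Cz']]] := n1P (maxn n0 n1) (leq_maxr _ _).
have cc' : c = c'.
  by move: kk'; rewrite kE kE' => /addrI/oppr_inj[].
rewrite -cc' in nz'.
have Czz' := normal_pair_joined nz nz' (connected_component_sub Cz).
apply: connected_component_trans (connected_component_trans Cz Czz') _.
exact: connected_component_sym.
Qed.
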